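(* There exists an absolute constant $c>0$ such that for every positive integer $n$, \[\frac{1}{8\sqrt{d(n)}}\cdot \min_{r\mid n}\left(\frac{n}{r}+\sqrt{r}\right)\;\le\; \operatorname{disc}(\mathcal A_n)\;\le\; \min_{r\mid n}\left(\frac{n}{r}+c\sqrt{r}\,2^{\omega(r)}\right),\] where the minima are over positive divisors $r$ of $n$.
   Context: For a positive integer $n$, an arithmetic progression in $\mathbb{Z}_n$ is a set $\{a+kd: 0\le k<l\}$ with $a,d\in\mathbb{Z}_n$ and $l$ an integer with $0\le l\le n/\gcd(n,d)$ (here $\gcd(d,n)$ is computed for any integer representative of $d$, so $\gcd(0,n)=n$). $\mathcal A_n$ denotes the family of all arithmetic progressions in $\mathbb{Z}_n$. For $\chi:\mathbb{Z}_n\to\{1,-1\}$ and $A\subseteq\mathbb{Z}_n$, $\chi(A)=\sum_{x\in A}\chi(x)$, and $\operatorname{disc}(\mathcal A_n)=\min_{\chi:\mathbb{Z}_n\to\{1,-1\}}\max_{A\in\mathcal A_n}|\chi(A)|$. $d(n)$ is the number of positive divisors of $n$ and $\omega(r)$ is the number of distinct prime factors of $r$. *)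

(* Defs.v *)
From HB Require Import structures.
From mathcomp Require Import all_boot all_order all_algebra.
From mathcomp Require Import reals.
Set Implicit Arguments. Unset Strict Implicit. Unset Printing Implicit Defensive.
Import Order.TTheory GRing.Theory Num.Theory.

(* Z_n is represented by 'I_n (residues 0..n-1), used for n >= 1.
   The progression {a + k d : 0 <= k < l} in Z_n. *)
Definition AP (n : nat) (a d : 'I_n) (l : nat) : {set 'I_n} :=
  [set x : 'I_n | [exists k : 'I_l, val x == (a + k * d) %% n]].

Definition col_sum (n : nat) (chi : {ffun 'I_n -> bool}) (A : {set 'I_n}) : int :=
  \sum_(x in A) (if chi x then 1 else -1)%R.

(* max over all arithmetic progressions of |chi(A)|; the condition
   0 <= l <= n / gcd(n,d) (with gcdn 0 n = n) implies l <= n. *)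
Definition ap_disc (n : nat) (chi : {ffun 'I_n -> bool}) : nat :=
  \max_(a : 'I_n) \max_(d : 'I_n) \max_(l < n.+1 | l <= n %/ gcdn d n)
     `|col_sum chi (AP a d l)|%N.

(* disc(A_n) = min over colourings; the seed n of minn is harmless since
   every |chi(A)| <= n. *)
Definition disc_APn (n : nat) : nat :=
  \big[minn/n]_(chi : {ffun 'I_n -> bool}) ap_disc chi.

Definition ndiv (n : nat) : nat := size (divisors n).
Definition omega (r : nat) : nat := size (primes r).

(* minimum of f r over positive divisors r of n (seed f 1, 1 being a divisor) *)
Definition min_div (R : realType) (n : nat) (f : nat -> R) : R :=
  \big[Num.min/f 1%N]_(r <- divisors n) f r.

(* Main.v *)
Require Import Defs.
From HB Require Import structures.
From mathcomp Require Import all_boot all_order all_algebra.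
From mathcomp Require Import reals sequences exp trigo complex zify ring lra.
Import Order.TTheory GRing.Theory Num.Theory.
Local Open Scope ring_scope.
Set Implicit Arguments. Unset Strict Implicit. Unset Printing Implicit Defensive.

(** Upper bound.  Given [r %| n], pull back to Z_n a colouring [psi] of Z_r.
    An arithmetic progression of Z_n winds at most [n %/ r] times around a
    coset of Z_r and leaves a progression of Z_r without repetition, so it
    suffices that [psi] has sums at most 1 in absolute value on all cosets and
    [O(sqrt r * 2 ^ omega r)] on progressions.  In Z_(p^k) listed in
    digit-reversed order every coset is an interval; pairing positions [2i]
    and [2i+1] with opposite colours leaves at most one unpaired element per
    coset.  By the Chinese remainder theorem the products of such pairs are
    boxes of at most [2 ^ omega r] elements, and for every choice of one sign
    per box the coset sums are at most 1.  Each progression is a difference of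
    prefixes in one of at most [r * 2 ^ omega r] sequences of boxes, and the
    signs come from the partial colouring method with dyadic blocks (Matousek
    and Spencer).

    Lower bound.  Let [W r] be the Fourier mass of the colouring on the
    frequencies of order [r].  Averaging over translates, the progression with
    difference [r] and length [n %/ r] gives [W r * (n/r)^2 <= n^2 * disc^2],
    and the progressions of length about [r/8] with differences below [r] give
    [W r * r <= 49 * n^2 * disc^2], because for two differences the frequency
    becomes +-1/r.  Summing over [r] and using Parseval yields the claim. *)

(** * Partial colourings *)

Section Moments.
Variables (T : finType) (U : {set T}).
Implicit Types (A : {set T}) (s : seq T).

Definition sgn_of A (x : T) : int := if x \in A then 1 else -1.
Definition sgn_sum A s : int := \sum_(x <- s) sgn_of A x.
Definition toggle (u : T) A : {set T} := if u \in A then A :\ u else u |: A.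

Lemma in_toggle u A x : (x \in toggle u A) = ((x == u) (+) (x \in A)).
Proof.
rewrite /toggle; case: (boolP (u \in A)) => uA; rewrite !inE;
  case: eqVneq => [->|] //=; by rewrite ?uA // (negbTE uA).
Qed.

Lemma toggleK u : involutive (toggle u).
Proof. by move=> A; apply/setP => x; rewrite !in_toggle addbA addbb. Qed.

Lemma toggle_powerset u A : u \in U -> (toggle u A \in powerset U) = (A \in powerset U).
Proof.
move=> uU; rewrite !powersetE; apply/subsetP/subsetP => sub x.
  by move=> xA; case: (eqVneq x u) => [->//|nxu]; apply: sub; rewrite in_toggle (negbTE nxu).
by rewrite in_toggle; case: (eqVneq x u) => [->//|nxu] /=; apply: sub.
Qed.

Lemma sgn_of_toggle u A : sgn_of (toggle u A) u = - sgn_of A u.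
Proof. by rewrite /sgn_of in_toggle eqxx /=; case: (u \in A). Qed.

Lemma sgn_sum_toggle u A s : u \notin s -> sgn_sum (toggle u A) s = sgn_sum A s.
Proof.
move=> us; apply: eq_big_seq => x xs; rewrite /sgn_of in_toggle.
by case: (eqVneq x u) us xs => [-> /negP|].
Qed.

(* Toggling [u] is an involution of [powerset U]: average over its orbits. *)
Lemma sum_sgn_cons (f : int -> int) u s : u \in U -> u \notin s ->
  (\sum_(A in powerset U) f (sgn_sum A (u :: s))) *+ 2 =
  \sum_(A in powerset U) (f (1 + sgn_sum A s) + f (-1 + sgn_sum A s)).
Proof.
move=> uU us; rewrite mulr2n.
rewrite {2}(reindex_inj (can_inj (toggleK u))) /=.
under [X in _ + X]eq_bigl => A do rewrite toggle_powerset //.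
rewrite -big_split /=; apply: eq_bigr => A _.
rewrite /sgn_sum !big_cons -!/(sgn_sum _ s) sgn_sum_toggle // sgn_of_toggle.
by rewrite /sgn_of; case: ifP => _; rewrite ?opprK // addrC.
Qed.

(** Averaging over the sign of a new element kills the odd powers in the binomial expansion, and the
    rest stays below the Gaussian moments 1, 3, 15, 105. The lower moments carry the induction up to
    the eighth. *)
Lemma moment_bounds s : uniq s -> {subset s <= U} ->
  let M k := \sum_(A in powerset U) sgn_sum A s ^+ k in
  let n := (size s)%:R in let N := #|powerset U|%:R in
  [/\ M 2 <= n * N, M 4 <= 3 * n ^+ 2 * N, M 6 <= 15 * n ^+ 3 * N
    & M 8 <= 105 * n ^+ 4 * N].
Proof.
elim: s => [|u s IH] /=.
  move=> _ _; split; rewrite ?expr0n /= ?mulr0 mul0r big1 // => A _;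
  by rewrite /sgn_sum big_nil expr0n.
case/andP=> us ss sub.
have uU : u \in U by apply: sub; rewrite inE eqxx.
have [|] := IH ss; first by move=> x xs; apply: sub; rewrite inE xs orbT.
set N : int := #|_|%:R; set n : int := (size s)%:R.
have n0 : 0 <= n by rewrite /n ler0n.
have N0 : 0 <= N by rewrite /N ler0n.
have -> : (size s).+1%:R = n + 1 :> int by rewrite -natr1.
have sumN : \sum_(A in powerset U) (1 : int) = N by rewrite sumr_const.
pose M k := \sum_(A in powerset U) sgn_sum A s ^+ k.
rewrite -!/(M _).
move=> h2 h4 h6 h8.
have step2 : (\sum_(A in powerset U) sgn_sum A (u :: s) ^+ 2) = M 2 + N.
  suff : (\sum_(A in powerset U) sgn_sum A (u :: s) ^+ 2) *+ 2 = (M 2 + N) *+ 2 by lia.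
  rewrite (@sum_sgn_cons (fun x => x ^+ 2)) // /M -sumN -big_split /= -sumrMnl.
  by apply: eq_bigr => A _; ring.
have step4 : (\sum_(A in powerset U) sgn_sum A (u :: s) ^+ 4) = M 4 + 6 * M 2 + N.
  suff : (\sum_(A in powerset U) sgn_sum A (u :: s) ^+ 4) *+ 2 = (M 4 + 6 * M 2 + N) *+ 2 by lia.
  rewrite (@sum_sgn_cons (fun x => x ^+ 4)) // /M -sumN mulr_sumr -!big_split /= -sumrMnl.
  by apply: eq_bigr => A _; ring.
have step6 : (\sum_(A in powerset U) sgn_sum A (u :: s) ^+ 6) =
    M 6 + 15 * M 4 + 15 * M 2 + N.
  suff : (\sum_(A in powerset U) sgn_sum A (u :: s) ^+ 6) *+ 2 =
    (M 6 + 15 * M 4 + 15 * M 2 + N) *+ 2 by lia.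
  rewrite (@sum_sgn_cons (fun x => x ^+ 6)) // /M -sumN !mulr_sumr -!big_split /= -sumrMnl.
  by apply: eq_bigr => A _; ring.
have step8 : (\sum_(A in powerset U) sgn_sum A (u :: s) ^+ 8) =
    M 8 + 28 * M 6 + 70 * M 4 + 28 * M 2 + N.
  suff : (\sum_(A in powerset U) sgn_sum A (u :: s) ^+ 8) *+ 2 =
    (M 8 + 28 * M 6 + 70 * M 4 + 28 * M 2 + N) *+ 2 by lia.
  rewrite (@sum_sgn_cons (fun x => x ^+ 8)) // /M -sumN !mulr_sumr -!big_split /= -sumrMnl.
  by apply: eq_bigr => A _; ring.
rewrite step2 step4 step6 step8.
have p1 : 0 <= n * N by rewrite mulr_ge0.
have p2 : 0 <= n ^+ 2 * N by rewrite mulr_ge0 // exprn_ge0.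
have p3 : 0 <= n ^+ 3 * N by rewrite mulr_ge0 // exprn_ge0.
move: (M 2) (M 4) (M 6) (M 8) h2 h4 h6 h8 => m2 m4 m6 m8 h2 h4 h6 h8.
clear -h2 h4 h6 h8 p1 p2 p3 N0; move: n N N0 h2 h4 h6 h8 p1 p2 p3 => n N.
by split; lra.
Qed.

End Moments.

(** * Hamming balls in a power set *)

Section Hamming.
Variables (T : finType) (U : {set T}).
Implicit Types (A B : {set T}).

Definition symdiff A B : {set T} := [set x | (x \in A) != (x \in B)].

Lemma symdiffK A : involutive (symdiff A).
Proof. by move=> B; apply/setP => x; rewrite !inE; case: (x \in A) (x \in B) => [] []. Qed.

Lemma symdiff_powerset A B : A \subset U ->
  (symdiff A B \in powerset U) = (B \in powerset U).
Proof.
move=> /subsetP AU; rewrite !powersetE; apply/subsetP/subsetP => sub x xB.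
  by case: (boolP (x \in A)) => [/AU //|xA]; apply: sub; rewrite inE xB (negbTE xA).
by move: xB; rewrite inE; case: (boolP (x \in A)) => [/AU //|_]; case: (boolP (x \in B)) => // /sub.
Qed.

Lemma sum_expr_card (R : comNzRingType) (z : R) :
  \sum_(C in powerset U) z ^+ #|C| = (1 + z) ^+ #|U|.
Proof.
have <- : \prod_i ((if i \in U then z else 0) + 1 : R) = (1 + z) ^+ #|U|.
  rewrite -prodr_const [RHS]big_mkcond /=; apply: eq_bigr => i _.
  by case: ifP; rewrite ?add0r // addrC.
rewrite bigA_distr big_mkcond [RHS]big_mkcond /=; apply: eq_bigr => C _.
rewrite powersetE; case: (boolP (C \subset U)) => [/subsetP sub|/subsetPn[x xC xU]].
  rewrite -prodr_const [LHS]big_mkcond /=; apply: eq_bigr => i _.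
  by case: ifP => // /sub ->.
by rewrite (bigD1 x) //= xC (negbTE xU) mul0r.
Qed.

(** Weights [8^-1 ^+ #|symdiff A B|] add up to [(9 / 8) ^+ #|U|] over all [B], while each member of
    the ball weighs at least [8^-1 ^+ (#|U| %/ 16)]. As [(9 / 8) ^+ 16 <= 8], the sixteenth power is
    at most [8 ^+ #|U| * 8 ^+ #|U|]. *)
Lemma hamming_ball_card (R : realFieldType) A : A \subset U ->
  (#|[set B in powerset U | (16 * #|symdiff A B| <= #|U|)%N]|%:R : R) ^+ 16 <= 64 ^+ #|U|.
Proof.
move=> AU; set S := [set B in _ | _]; set m := #|U|.
have le1 : (#|S|%:R : R) * 8^-1 ^+ (m %/ 16) <= (9 / 8) ^+ m.
  have -> : (9 / 8 : R) = 1 + 8^-1 by lra.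
  rewrite -sum_expr_card (reindex_inj (can_inj (symdiffK A))) /=.
  under eq_bigl => B do rewrite symdiff_powerset //.
  apply: (@le_trans _ _ (\sum_(B in S) 8^-1 ^+ #|symdiff A B|)).
    rewrite mulr_natl -sumr_const; apply: ler_sum => B; rewrite inE => /andP[_ h].
    by apply: ler_wiXn2l; [lra|lra|rewrite leq_divRL // mulnC].
  rewrite big_mkcond [leRHS]big_mkcond /=; apply: ler_sum => B _.
  rewrite inE; case: (B \in _) => //=; case: ifP => // _.
  by rewrite exprn_ge0 // invr_ge0.
have le2 : (#|S|%:R : R) <= (9 / 8) ^+ m * 8 ^+ (m %/ 16).
  by rewrite -ler_pdivrMr ?exprn_gt0 // -exprVn.
apply: (@le_trans _ _ (((9 / 8) ^+ m * 8 ^+ (m %/ 16)) ^+ 16)).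
  by apply: lerXn2r => //; rewrite nnegrE ?ler0n // mulr_ge0 // exprn_ge0 //; lra.
rewrite exprMn -!exprM (mulnC m) exprM.
apply: (@le_trans _ _ (8 ^+ m * 8 ^+ m)).
  apply: ler_pM; rewrite ?exprn_ge0 //; try lra.
    by apply: lerXn2r; rewrite ?nnegrE ?exprn_ge0 //; lra.
  by apply: ler_weXn2l; [lra|rewrite leq_trunc_div].
by rewrite -exprMn; apply: lerXn2r; rewrite ?nnegrE; lra.
Qed.

End Hamming.

Lemma geometric_tail_le (R : realFieldType) (y : R) n : 0 <= y <= 1 / 2 ->
  \sum_(k < n) y ^+ k.+1 <= 2 * y.
Proof.
case/andP=> y0 y1.
suff : \sum_(k < n) y ^+ k.+1 <= 2 * y * (1 - y ^+ n).
  move/le_trans; apply; have yn : 0 <= y ^+ n by apply: exprn_ge0.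
  by have := mulr_ge0 y0 yn; lra.
elim: n => [|n IH]; first by rewrite big_ord0 expr0 subrr mulr0.
rewrite big_ord_recr /= exprS; have : 0 <= y ^+ n by apply: exprn_ge0.
move: IH; set s := \sum_(_ < _) _; set yn := y ^+ n => IH yn0.
have h1 : 0 <= y * yn by rewrite mulr_ge0.
have h2 : 0 <= (1 / 2 - y) * (y * yn) by rewrite mulr_ge0 // subr_ge0.
by move: h2; rewrite mulrBl !mulrA => h2; lra.
Qed.

(* Weighted pigeonhole: a colouring [A] is encoded by the rounded values
   [|A(S i)| %/ D i] (with signs), a nonzero value [q] being charged [a i * q]
   bits.  [kraft] bounds the total weight of all codes and [cost] the expected
   code length, so that some code is shared by more colourings than fit into a
   Hamming ball of radius [#|U| / 16]; half the difference of two distant such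
   colourings is the desired partial colouring. *)
Section PartialColouring.
Variables (R : realType) (T I : finType) (U : {set T}).
Variables (S : I -> seq T) (D a : I -> nat).
Hypothesis S_uniq : forall i, uniq (S i).
Hypothesis S_sub : forall i, {subset S i <= U}.
Hypothesis D_gt0 : forall i, (0 < D i)%N.
Hypothesis a_gt0 : forall i, (0 < a i)%N.
Hypothesis U_gt2 : (2 < #|U|)%N.
Hypothesis kraft : \sum_i (2^-1 : R) ^+ a i <= #|U|%:R / 128.
Hypothesis cost :
  \sum_i (a i)%:R * ((105 * size (S i) ^ 4)%:R / (D i ^ 8)%:R) <= #|U|%:R / 16 :> R.
Implicit Types (A B : {set T}) (i : I).

Let quo A i : nat := (`|sgn_sum A (S i)| %/ D i)%N.
Let len A : nat := (\sum_i a i * quo A i)%N.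
Let good : {set {set T}} := [set A in powerset U | (8 * len A <= #|U|)%N].
(** The sign is normalised to [true] when the rounded value is 0, so that 0 has only one code;
    accordingly [weight] gives 1 to [(true, 0)] and 0 to [(false, 0)]. *)
Let code A : {ffun I -> bool * 'I_(#|U|.+1)} :=
  [ffun i => (if quo A i == 0%N then true else 0 <= sgn_sum A (S i), inord (quo A i))].
Let weight i (c : bool * 'I_(#|U|.+1)) : R :=
  if c.2 == 0%N :> nat then c.1%:R else 2^-1 ^+ (a i * c.2).

Let size_S i : (size (S i) <= #|U|)%N.
Proof. by rewrite -(card_uniqP (S_uniq i)); apply/subset_leq_card/subsetP/S_sub. Qed.

Let sgn_sum_le A s : (`|sgn_sum A s| <= size s)%N.
Proof.
rewrite /sgn_sum; elim: s => [|x s IH]; first by rewrite big_nil.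
rewrite big_cons; move: (\sum_(_ <- s) _) IH => t IH.
by rewrite /sgn_of /=; case: ifP => _; lia.
Qed.

Let quo_le A i : (quo A i < #|U|.+1)%N.
Proof.
rewrite ltnS; apply: leq_trans (size_S i); apply: leq_trans (sgn_sum_le A _).
exact: leq_div.
Qed.

(** Markov's inequality with eighth moments: a natural number is at most its eighth power, and
    [quo A i * D i] is at most the absolute signed sum. *)
Let quo_moment i : \sum_(A in powerset U) (quo A i)%:R <=
  (105 * size (S i) ^ 4)%:R / (D i ^ 8)%:R * 2 ^+ #|U| :> R.
Proof.
have h : (\sum_(A in powerset U) quo A i * D i ^ 8 <= 105 * size (S i) ^ 4 * 2 ^ #|U|)%N.
  apply: (@leq_trans (\sum_(A in powerset U) `|sgn_sum A (S i)| ^ 8)%N).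
    apply: leq_sum => A _; apply: (@leq_trans (quo A i ^ 8 * D i ^ 8)%N).
      rewrite leq_mul2r; apply/orP; right; case: (quo A i) => // q.
      by rewrite -{1}(expn1 q.+1) leq_pexp2l.
    by rewrite -expnMn leq_exp2r // leq_trunc_div.
  have [_ _ _] := moment_bounds (S_uniq i) (@S_sub i).
  rewrite card_powerset -lez_nat => h8.
  suff -> : (\sum_(A in powerset U) `|sgn_sum A (S i)| ^ 8)%:Z =
            \sum_(A in powerset U) sgn_sum A (S i) ^+ 8.
    by apply: le_trans h8 _; rewrite !natz !PoszM; lia.
  rewrite -natz natr_sum; apply: eq_bigr => A _.
  by rewrite natz -abszX abszE ger0_norm // (exprM _ 2 4) exprn_ge0 // sqr_ge0.
rewrite mulrAC ler_pdivlMr ?ltr0n ?expn_gt0 ?D_gt0 // mulr_suml.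
under eq_bigr => A _ do rewrite -natrM.
by rewrite -natr_sum -(natrX _ 2) -natrM ler_nat.
Qed.

Let sum_len : \sum_(A in powerset U) (len A)%:R <= 2 ^+ #|U| * (#|U|%:R / 16) :> R.
Proof.
under eq_bigr => A _ do rewrite natr_sum.
rewrite exchange_big /=.
apply: (@le_trans _ _ (2 ^+ #|U| * \sum_i (a i)%:R * ((105 * size (S i) ^ 4)%:R / (D i ^ 8)%:R))); last first.
  by rewrite ler_wpM2l // exprn_ge0.
rewrite mulr_sumr; apply: ler_sum => i _.
under eq_bigr => A _ do rewrite natrM.
by rewrite -mulr_sumr [leRHS]mulrCA ler_wpM2l ?ler0n // mulrC quo_moment.
Qed.

(** The mean of [len] is at most [#|U| / 16], so by Markov at most half of the colourings exceed
    [#|U| / 8]. *)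
Let card_good : 2 ^+ #|U| <= 2 * #|good|%:R :> R.
Proof.
set bad := powerset U :\: good.
have eqN : (#|good| + #|bad| = 2 ^ #|U|)%N.
  rewrite -card_powerset -(cardsID good (powerset U)); congr (_ + _)%N.
  by apply: eq_card => A; rewrite !inE; case: (_ \subset _).
have leB : #|bad|%:R * (#|U|%:R / 8) <= 2 ^+ #|U| * (#|U|%:R / 16) :> R.
  apply: le_trans sum_len; rewrite mulr_natl -sumr_const.
  rewrite big_mkcond [leRHS]big_mkcond /=; apply: ler_sum => A _.
  rewrite !inE; case: (_ \subset _) => /=; rewrite ?andbF ?andbT //.
  case: ltnP => //= h; rewrite ler_pdivrMr // -natrM ler_nat; lia.
have U0 : 0 < #|U|%:R :> R by rewrite ltr0n; lia.
have -> : 2 ^+ #|U| = #|good|%:R + #|bad|%:R :> R by rewrite -natrX -natrD eqN.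
have : #|bad|%:R <= 2 ^+ #|U| / 2 :> R.
  rewrite -(ler_pM2r U0); move: leB; lra.
rewrite -natrX -eqN natrD; lra.
Qed.

Let weight_code A : \prod_i weight i (code A i) = 2^-1 ^+ len A.
Proof.
rewrite -prodrXr; apply: eq_bigr => i _; rewrite /weight ffunE /= inordK //.
by case: eqP => [->|//]; rewrite muln0 expr0.
Qed.

(** The sum factors over [i]. With [y = 2^-1 ^+ a i <= 1 / 2] a factor is at most [1 + 2 * (y + y^2
    + ...) <= 1 + 4 * y <= expR (4 * y)], and [kraft] bounds the total exponent. *)
Let sum_weight : \sum_(c : {ffun I -> bool * 'I_(#|U|.+1)}) \prod_i weight i (c i) <=
  expR (#|U|%:R / 32).
Proof.
rewrite -(bigA_distr_bigA weight) /=.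
apply: (@le_trans _ _ (expR (\sum_i 4 * 2^-1 ^+ a i))); last first.
  by rewrite ler_expR -mulr_sumr; move: kraft; move: (\sum_i _) => s; lra.
rewrite expR_sum; apply: ler_prod => i _; apply/andP; split.
  by apply: sumr_ge0 => -[b k] _; rewrite /weight; case: ifP => _ /=; rewrite ?ler0n ?exprn_ge0 ?invr_ge0.
apply: le_trans (expR_ge1Dx _).
rewrite -(pair_bigA _ (fun b k => weight i (b, k))) /= big_bool /=.
rewrite !big_ord_recl.
have y0 : 0 <= (2^-1 : R) ^+ a i <= 1 / 2.
  apply/andP; split; first by rewrite exprn_ge0 // invr_ge0.
  by rewrite mul1r -[leRHS]expr1; apply: ler_wiXn2l => //; lra.
have tailE b : \sum_(k < #|U|) weight i (b, lift ord0 k) =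
    \sum_(k < #|U|) (2^-1 ^+ a i) ^+ k.+1.
  by apply: eq_bigr => k _; rewrite /weight /= exprM.
rewrite !tailE {1 2}/weight /=.
by have := geometric_tail_le #|U| y0; move: (\sum_(_ < _) _) => t; lra.
Qed.

Let code_close A B i : code A = code B ->
  (`|sgn_sum A (S i) - sgn_sum B (S i)| <= 2 * D i)%N.
Proof.
move/ffunP/(_ i); rewrite !ffunE => -[sE] /(congr1 val); rewrite /= !inordK // => qE.
move: sE; rewrite qE.
have := divn_eq `|sgn_sum A (S i)|%N (D i); rewrite -/(quo A i) qE.
have := divn_eq `|sgn_sum B (S i)|%N (D i); rewrite -/(quo B i).
have := ltn_pmod `|sgn_sum A (S i)|%N (D_gt0 i); have := ltn_pmod `|sgn_sum B (S i)|%N (D_gt0 i).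
clear qE; move: (quo B i) (sgn_sum A (S i)) (sgn_sum B (S i)) => q x y.
by case: eqP => [->|_]; [rewrite mul0n|move: (q * D i)%N => qD]; lia.
Qed.

Lemma partial_colouring : exists y : T -> int,
  [/\ forall x, y x \in [:: -1; 0; 1],
      forall x, y x != 0 -> x \in U,
      (#|U| < 16 * #|[set x | y x != 0]|)%N
    & forall i, `|\sum_(x <- S i) y x| <= (D i)%:Z].
Proof.
case: (boolP [exists A in good, exists B in good,
    (code A == code B) && (#|U| < 16 * #|symdiff A B|)%N]).
  move=> /exists_inP[A Ag /exists_inP[B Bg /andP[/eqP cE far]]].
  exists (fun x => (x \in A)%:R - (x \in B)%:R); split.
  - by move=> x; case: (x \in A); case: (x \in B).
  - move=> x; move: Ag Bg; rewrite !inE => /andP[/subsetP/(_ x) h1 _] /andP[/subsetP/(_ x) h2 _].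
    by case: (boolP (x \in A)) => [/h1 //|_]; case: (boolP (x \in B)) => [/h2 //|_].
  - suff -> : [set x | (x \in A)%:R - (x \in B)%:R != 0 :> int] = symdiff A B by [].
    by apply/setP => x; rewrite !inE; case: (x \in A); case: (x \in B).
  - move=> i; have := code_close i cE.
    have -> : sgn_sum A (S i) - sgn_sum B (S i) =
        2 * \sum_(x <- S i) ((x \in A)%:R - (x \in B)%:R).
      rewrite /sgn_sum -sumrB mulr_sumr; apply: eq_bigr => x _.
      by rewrite /sgn_of; case: (x \in A); case: (x \in B).
    by move: (\sum_(_ <- _) _) (D i) => t D'; lia.
(* Without a distant pair every code class of good colourings lies in a Hamming ball. With [Z] the
   largest class size, comparing total weights gives the upper bound [main] on [#|good|], which
   contradicts [card_good]. *)
rewrite negb_exists_in => /forall_inP no_pair; exfalso.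
have class_le A0 : A0 \in good ->
    (#|[set A in good | code A == code A0]|%:R : R) ^+ 16 <= 64 ^+ #|U|.
  move=> A0g; have A0U : A0 \subset U by move: A0g; rewrite !inE => /andP[].
  apply: le_trans (hamming_ball_card R A0U); apply: lerXn2r; rewrite ?nnegrE ?ler0n //.
  rewrite ler_nat; apply: subset_leq_card; apply/subsetP => A; rewrite inE => /andP[Ag cA].
  have := no_pair _ A0g; rewrite negb_exists_in => /forall_inP/(_ _ Ag).
  rewrite eq_sym cA /= -leqNgt => d16; rewrite inE d16 andbT.
  by move: Ag; rewrite inE => /andP[].
pose Z : nat := \max_(A in good) #|[set B in good | code B == code A]|.
have Z16 : (Z%:R : R) ^+ 16 <= 64 ^+ #|U|.
  rewrite /Z; elim/big_ind: _ => [|x y hx hy|A /class_le //].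
    by rewrite expr0n exprn_ge0.
  by rewrite /maxn; case: ifP.
have main : #|good|%:R * 2^-1 ^+ (#|U| %/ 8) <= Z%:R * expR (#|U|%:R / 32) :> R.
  apply: (@le_trans _ _ (\sum_(A in good) \prod_i weight i (code A i))).
    rewrite mulr_natl -sumr_const; apply: ler_sum => A; rewrite inE weight_code => /andP[_ h].
    by apply: ler_wiXn2l; [lra|lra|rewrite leq_divRL // mulnC].
  rewrite (partition_big code predT) //=.
  apply: (@le_trans _ _ (\sum_(c : {ffun I -> bool * 'I_(#|U|.+1)}) Z%:R * \prod_i weight i (c i))); last first.
    by rewrite -mulr_sumr ler_wpM2l ?ler0n.
  apply: ler_sum => c _.
  have w0 : 0 <= \prod_i weight i (c i).
    apply: prodr_ge0 => i _; rewrite /weight; case: ifP => _; first by rewrite ler0n.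
    by rewrite exprn_ge0 // invr_ge0.
  have -> : \sum_(A in good | code A == c) \prod_i weight i (code A i) =
      \sum_(A in [set A in good | code A == c]) \prod_i weight i (c i).
    by apply: eq_big => A; rewrite ?inE // => /andP[_ /eqP ->].
  rewrite sumr_const -[leLHS]mulr_natl ler_wpM2r // ler_nat.
  have [A /andP[Ag /eqP cA]|none] := pickP [pred A | (A \in good) && (code A == c)].
    by apply: leq_trans (leq_bigmax_cond _ Ag); rewrite -cA.
  by rewrite eq_card0 // => A; rewrite inE; apply: none.
have g2 := card_good; have n2 := U_gt2.
set n := #|U| in n2 g2 main Z16 *; set g : R := #|good|%:R in g2 main.
have g0 : 0 <= g by rewrite /g ler0n.
have e16 : expR (n%:R / 32 : R) ^+ 16 <= 2 ^+ n.
  rewrite -expRM_natr; have -> : n%:R / 32 * 16%:R = n%:R * (1 / 2) :> R by lra.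
  rewrite expRM_natl; apply: lerXn2r; rewrite ?nnegrE ?expR_ge0 //.
  have : 1 / 2 <= expR (- (1 / 2) : R) by apply: le_trans (expR_ge1Dx _); lra.
  rewrite expRN => h; have e0 := expR_gt0 (1 / 2 : R).
  have : 1 / 2 * expR (1 / 2) <= 1 :> R by rewrite -ler_pdivlMr // [1 / expR _]mul1r.
  by move: (expR _) => e; lra.
(* Sixteenth powers clear all fractional exponents. The exponents of 2 then read
   [16 n <= 16 + 2 n + 6 n + n], which is false for [n > 2]. *)
have lhs : 2 ^+ (16 * n) <= (2 ^+ 16 * 2 ^+ (2 * n)) * (64 ^+ n * 2 ^+ n) :> R.
  have h1 : g <= (Z%:R * expR (n%:R / 32)) * 2 ^+ (n %/ 8).
    by rewrite -ler_pdivrMr ?exprn_gt0 // -exprVn.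
  have h2 : (2 ^+ n : R) <= 2 * ((Z%:R * expR (n%:R / 32)) * 2 ^+ (n %/ 8)) by lra.
  rewrite mulnC exprM; apply: (@le_trans _ _ ((2 * ((Z%:R * expR (n%:R / 32)) * 2 ^+ (n %/ 8))) ^+ 16)).
    by apply: lerXn2r => //; rewrite nnegrE ?exprn_ge0 // ?mulr_ge0 ?ler0n ?expR_ge0 ?exprn_ge0.
  rewrite !exprMn -[leRHS]mulrA ler_wpM2l ?exprn_ge0 // mulrC.
  apply: ler_pM; rewrite ?mulr_ge0 ?exprn_ge0 ?expR_ge0 ?ler0n //.
    by rewrite -exprM; apply: ler_weXn2l; [lra|rewrite (mulnA _ 8 2) mulnC leq_mul2l leq_trunc_div].
  by apply: ler_pM; rewrite ?exprn_ge0 ?expR_ge0 ?ler0n.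
move: lhs; rewrite (_ : 64 = 2 ^+ 6 :> R); last by rewrite -natrX.
rewrite -exprM -!exprD ler_eXn2l; last by lra.
by move: (n) n2; clear; lia.
Qed.

End PartialColouring.

(** * Prefixes of many sequences *)

(** The binary digits of [t] cut the prefix into at most one aligned dyadic block of each size. *)
Lemma prefix_dyadic (T : Type) (y : T -> int) (s : seq T) (D : nat -> int) mu :
  (forall i j, (i <= mu)%N -> (j < 2 ^ (mu - i))%N ->
     `|\sum_(x <- take (2 ^ i) (drop (j * 2 ^ i) s)) y x| <= D i) ->
  forall t, (t <= 2 ^ mu)%N ->
  `|\sum_(x <- take t s) y x| <= \sum_(i < mu.+1) D i.
Proof.
move=> block; pose P t := \sum_(x <- take t s) y x.
have PD t w : P (t + w)%N = P t + \sum_(x <- take w (drop t s)) y x.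
  by rewrite /P takeD big_cat.
have P0 : P 0%N = 0 by rewrite /P take0 big_nil.
have D0 i : (i <= mu)%N -> 0 <= D i.
  by move=> imu; apply: le_trans (block i 0%N imu _); rewrite ?expn_gt0.
(* Induction on the number [k] of halvings: an odd [u] splits off one block of size [2 ^ (mu - k)],
   and the remaining even multiple is a multiple of the next larger size. *)
suff main k u : (k <= mu)%N -> (u <= 2 ^ k)%N ->
    `|P (u * 2 ^ (mu - k))%N| <= \sum_(mu - k <= i < mu.+1) D i.
  by move=> t tmu; have := main mu t (leqnn _) tmu; rewrite subnn muln1 big_mkord.
elim: k u => [|k IH] u kmu uk.
  rewrite subn0 big_nat1; case: u uk => [|[|//]] _; first by rewrite mul0n P0 normr0 D0.
  rewrite mul1n -[(2 ^ mu)%N]add0n PD P0 add0r -(mul0n (2 ^ mu)%N).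
  by apply: block; rewrite // subnn.
have eS : (mu - k = (mu - k.+1).+1)%N by lia.
rewrite big_ltn; last by lia.
have u2 := odd_double_half u; rewrite expnS in uk.
have hP : `|P (u./2 * (2 * 2 ^ (mu - k.+1)))%N| <= \sum_((mu - k.+1).+1 <= i < mu.+1) D i.
  by rewrite -expnS -eS; apply: IH; [exact: ltnW|lia].
rewrite -{1}u2 mulnDl addnC.
have -> : (u./2.*2 * 2 ^ (mu - k.+1) = u./2 * (2 * 2 ^ (mu - k.+1)))%N by lia.
rewrite PD addrC; apply: le_trans (ler_normD _ _) _; apply: lerD => //.
case odd_u : (odd u); rewrite odd_u in u2; last first.
  by rewrite mul0n take0 big_nil normr0 D0; lia.
rewrite mul1n; have -> : (u./2 * (2 * 2 ^ (mu - k.+1)) = u./2.*2 * 2 ^ (mu - k.+1))%N by lia.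
apply: block; first by lia.
by rewrite subKn // expnS; lia.
Qed.

Lemma sum_sub_ord_le (R : numDomainType) (f : nat -> R) (kap mu : nat) : (mu <= kap)%N ->
  (forall e, 0 <= f e) -> \sum_(i < mu.+1) f (kap - i)%N <= \sum_(e < kap.+1) f e.
Proof.
move=> le f0; rewrite [leRHS](reindex_inj rev_ord_inj) /=.
under [leRHS]eq_bigr => i _ do rewrite subSS.
rewrite -(big_mkord predT (fun i => f (kap - i)%N)) -(big_mkord predT (fun i => f (kap - i)%N)).
by rewrite [leRHS](big_cat_nat (n := mu.+1)) //= lerDl; apply: sumr_ge0.
Qed.

(** * Growth of the allowed deviation across scales *)

Section Orders.
Variable R : realType.

(* The base 11/10 is any [x] with [2 < x ^ 8] (convergence of the total cost,
   using eighth moments) and [x ^ 6 <= 2] (see [growth_le_sqrt]). *)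
Definition growth (kap mu : nat) : R := (11 / 10) ^+ (kap - mu) * Num.sqrt 2 ^+ mu.

Let sq2 : Num.sqrt 2 ^+ 2 = 2 :> R. Proof. by rewrite sqr_sqrtr. Qed.

Lemma sqrt2_ge : 11 / 8 <= Num.sqrt 2 :> R.
Proof.
by rewrite -(ler_pXn2r (n := 2)) ?nnegrE ?sqrtr_ge0 ?sq2 //; lra.
Qed.

Lemma growth_ge1 kap mu : 1 <= growth kap mu.
Proof.
rewrite /growth; apply: mulr_ege1; apply: exprn_ege1; first by lra.
by have := sqrt2_ge; lra.
Qed.

(** The ratio of consecutive values is [(11 / 10) / Num.sqrt 2], at most 4/5 because
    [Num.sqrt 2 >= 11 / 8]. Sums over scales are therefore geometric, dominated by five times the
    last term. *)
Lemma growthS kap mu : (mu < kap)%N -> growth kap mu <= 4 / 5 * growth kap mu.+1.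
Proof.
move=> h; rewrite /growth -subSS subSn // !exprS.
set a : R := (11 / 10) ^+ (kap - mu.+1); set b : R := Num.sqrt 2 ^+ mu.
have a0 : 0 <= a by apply: exprn_ge0; lra.
have b0 : 0 <= b by apply: exprn_ge0; rewrite sqrtr_ge0.
have s0 : 0 <= Num.sqrt 2 - 11 / 8 :> R by rewrite subr_ge0 sqrt2_ge.
have := mulr_ge0 (mulr_ge0 a0 b0) s0; have := mulr_ge0 a0 b0.
by move: a b a0 b0 s0 (Num.sqrt 2) => a b a0 b0 s0 r; lra.
Qed.

Lemma growth_le kap mu mu' : (mu <= mu' <= kap)%N -> growth kap mu <= growth kap mu'.
Proof.
case/andP; elim: mu' => [|k IH]; first by rewrite leqn0 => /eqP ->.
rewrite leq_eqVlt => /predU1P[-> //|]; rewrite ltnS => /IH h k1.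
apply: le_trans (h (ltnW k1)) _; apply: le_trans (growthS k1) _.
by have := growth_ge1 kap k.+1; lra.
Qed.

Lemma sum_growth_le kap mu : (mu <= kap)%N ->
  \sum_(i < mu.+1) growth kap i <= 5 * growth kap mu.
Proof.
elim: mu => [|mu IH] h; first by rewrite big_ord1; have := growth_ge1 kap 0; lra.
rewrite big_ord_recr /=; have := IH (ltnW h); have := growthS h; lra.
Qed.

Lemma sum_half_le n : \sum_(e < n) (2^-1 : R) ^+ e <= 2.
Proof.
suff : \sum_(e < n) (2^-1 : R) ^+ e <= 2 - 2 * 2^-1 ^+ n.
  move/le_trans; apply; have : 0 <= (2^-1 : R) ^+ n by apply: exprn_ge0; lra.
  by lra.
elim: n => [|n IH]; first by rewrite big_ord0 expr0; lra.
by rewrite big_ord_recr /= exprS; lra.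
Qed.

Lemma sum_linear_geometric_le n :
  \sum_(e < n) (2 * e + 9)%:R * (2 / (11 / 10) ^+ 8) ^+ e <= 640 :> R.
Proof.
set rho : R := 2 / _.
have rho0 : 0 <= rho by rewrite /rho; apply: divr_ge0 => //; apply: exprn_ge0; lra.
have rho1 : rho <= 934 / 1000.
  by rewrite /rho ler_pdivrMr; [lra|apply: exprn_gt0; lra].
(* A telescoping majorant: for [rho <= 934 / 1000] the coefficients 640 and 32 satisfy [2 n + 9 <=
   (640 + 32 n) - rho * (640 + 32 (n + 1))]. *)
suff : \sum_(e < n) (2 * e + 9)%:R * rho ^+ e <= 640 - (640 + 32 * n%:R) * rho ^+ n.
  move/le_trans; apply; have : 0 <= (640 + 32 * n%:R) * rho ^+ n.
    by rewrite mulr_ge0 ?exprn_ge0 // addr_ge0 // mulr_ge0.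
  by lra.
elim: n => [|n IH]; first by rewrite big_ord0 expr0; lra.
rewrite big_ord_recr /= exprS -natr1 natrD natrM.
have r0 : 0 <= rho ^+ n by apply: exprn_ge0.
have n0 : 0 <= n%:R :> R by [].
have : 0 <= (934 / 1000 - rho) * (640 + 32 * (n%:R + 1)) * rho ^+ n.
  by rewrite !mulr_ge0 //; lra.
have : 0 <= n%:R * rho ^+ n by rewrite mulr_ge0.
move: IH; move: (\sum_(_ < _) _) (rho ^+ n) r0 => s r r0 h1 h2 h3; lra.
Qed.

End Orders.

Lemma filter_take (T : Type) (a : pred T) t (s : seq T) :
  filter a (take t s) = take (count a (take t s)) (filter a s).
Proof. by rewrite -{3}(cat_take_drop t s) filter_cat -size_filter take_size_cat. Qed.

(** * One partial colouring controlling all prefixes *)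

Section Step.
Variables (R : realType) (T I : finType) (s : I -> seq T) (kap mu : nat) (U : {set T}).
Hypothesis s_uniq : forall k, uniq (s k).
Hypothesis I_le : (#|I| <= 2 ^ kap)%N.
Hypothesis mu_le : (mu <= kap)%N.
Hypothesis U_le : (#|U| <= 2 ^ mu)%N.
Hypothesis U_ge : (2 ^ mu <= 2 * #|U|)%N.
Hypothesis U_gt2 : (2 < #|U|)%N.

(** With [e = kap - i] there are at most [2 ^ (mu + e)] blocks of size [2 ^ i]. Two bits per unit of
    [e] beat this count in [kraft], the 9 extra bits supplying the factor 1/512. In [cost] the
    factor [(11 / 10) ^+ (8 * e)] in the eighth power of [dev i] beats [2 ^+ e]. *)
Let dev (i : nat) : R := 8 * growth R kap i.
Let D (i : nat) : nat := (Num.truncn (dev i)).+1.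
Let bits (i : nat) : nat := (2 * (kap - i) + 9)%N.
Let block (i : nat) (k : I) (j : nat) : seq T :=
  take (2 ^ i) (drop (j * 2 ^ i) [seq x <- s k | x \in U]).
Let J := {i : 'I_mu.+1 & (I * 'I_(2 ^ (mu - i)))%type}.

Let sumJ (F : nat -> R) :
  \sum_(p : J) F (tag p) = \sum_(i < mu.+1) (#|I| * 2 ^ (mu - i))%:R * F i.
Proof.
rewrite -(@sig_big_dep _ _ _ _ (fun i : 'I_mu.+1 => (I * 'I_(2 ^ (mu - i)))%type : finType)
   predT (fun _ => predT) (fun i _ => F i)) /=.
by apply: eq_bigr => i _; rewrite sumr_const cardE -cardT card_prod card_ord mulr_natl.
Qed.

Let count_le (i : nat) : (i <= mu)%N -> (#|I| * 2 ^ (mu - i))%:R <= 2 ^+ mu * 2 ^+ (kap - i) :> R.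
Proof.
move=> imu; rewrite -!natrX -natrM ler_nat -expnD.
apply: leq_trans (leq_mul I_le (leqnn _)) _.
by rewrite -expnD leq_exp2l //; lia.
Qed.

Let mu2 : 2 ^+ mu <= 2 * #|U|%:R :> R.
Proof. by rewrite -natrX -natrM ler_nat. Qed.

Let kraft : \sum_(p : J) (2^-1 : R) ^+ bits (tag p) <= #|U|%:R / 128.
Proof.
rewrite (sumJ (fun i => 2^-1 ^+ bits i)).
apply: (@le_trans _ _ (\sum_(i < mu.+1) 2 ^+ mu / 512 * 2^-1 ^+ (kap - i))).
  apply: ler_sum => i _.
  have h := count_le (ltnSE (ltn_ord i)).
  apply: le_trans (ler_wpM2r _ h) _; first by apply: exprn_ge0; lra.
  have -> : (2^-1 : R) ^+ bits i = 2^-1 ^+ (kap - i) * 2^-1 ^+ (kap - i) / 512.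
    by rewrite /bits exprD mul2n -addnn exprD; congr (_ * _); rewrite exprVn -natrX.
  have pq : 2 ^+ (kap - i) * 2^-1 ^+ (kap - i) = 1 :> R by rewrite -exprMn mulfV ?expr1n ?pnatr_eq0.
  set w : R := 2 ^+ mu; set p : R := 2 ^+ _ in pq *; set q : R := 2^-1 ^+ _ in pq *.
  rewrite (_ : w * p * _ = (p * q) * (w / 512 * q)); first by rewrite pq mul1r.
  by ring.
rewrite -mulr_sumr.
have := sum_sub_ord_le mu_le (fun e => exprn_ge0 e (_ : 0 <= (2^-1 : R))).
move=> /(_ ltac:(by rewrite invr_ge0)) h; have h2 := le_trans h (sum_half_le R _).
apply: (@le_trans _ _ (2 ^+ mu / 512 * 2)); first by rewrite ler_wpM2l ?mulr_ge0 ?exprn_ge0 ?invr_ge0.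
by move: mu2; move: (2 ^+ mu) => w; lra.
Qed.

Let dev_ge8 i : 8 <= dev i.
Proof. by have := growth_ge1 R kap i; rewrite /dev; lra. Qed.

Let dev_lt_D i : dev i <= (D i)%:R.
Proof. by apply/ltW/truncnS_gt. Qed.

Let D_le i : (D i)%:R <= 9 * growth R kap i.
Proof.
rewrite /D -natr1; have := growth_ge1 R kap i.
have : (Num.truncn (dev i))%:R <= dev i by rewrite truncn_le; have := dev_ge8 i; lra.
by rewrite /dev; lra.
Qed.

Let size_block i k j : (size (block i k j) <= 2 ^ i)%N.
Proof. by rewrite size_take_min geq_minl. Qed.

Let cost : \sum_(p : J) (bits (tag p))%:R *
   ((105 * size (block (tag p) (tagged p).1 (tagged p).2) ^ 4)%:R / (D (tag p) ^ 8)%:R)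
   <= #|U|%:R / 16 :> R.
Proof.
apply: (@le_trans _ _ (\sum_(p : J) (bits (tag p))%:R * (105 * (2 ^+ (4 * tag p)) / dev (tag p) ^+ 8))).
  apply: ler_sum => p _; rewrite ler_wpM2l //; apply: ler_pM; rewrite ?invr_ge0 ?ler0n //.
  - by rewrite natrM ler_wpM2l // -natrX ler_nat mulnC expnM leq_exp2r // size_block.
  - rewrite lef_pV2 ?posrE.
    + by rewrite natrX lerXn2r ?nnegrE // ?dev_lt_D //; have := dev_ge8 (tag p); lra.
    + by rewrite ltr0n expn_gt0.
    + by apply: exprn_gt0; have := dev_ge8 (tag p); lra.
rewrite (sumJ (fun i => (bits i)%:R * (105 * (2 ^+ (4 * i)) / dev i ^+ 8))).
pose f e : R := (2 * e + 9)%:R * (2 / (11 / 10) ^+ 8) ^+ e.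
apply: (@le_trans _ _ (\sum_(i < mu.+1) 2 ^+ mu * (105 / 8 ^+ 8) * f (kap - i)%N)).
  apply: ler_sum => i _.
  have h := count_le (ltnSE (ltn_ord i)).
  apply: le_trans (ler_wpM2r _ h) _.
    have dev0 : 0 <= dev i ^+ 8 by apply: exprn_ge0; have := dev_ge8 i; lra.
    by apply: mulr_ge0 => //; apply: divr_ge0 => //; apply: mulr_ge0 => //; apply: exprn_ge0.
  rewrite le_eqVlt; apply/orP; left; apply/eqP.
  rewrite /f /bits /dev /growth; set e := (kap - i)%N.
  have hB : (Num.sqrt 2 ^+ i) ^+ 8 = 2 ^+ (4 * i) :> R.
    by rewrite -exprM (_ : (i * 8 = 2 * (4 * i))%N) ?exprM ?sqr_sqrtr //; lia.
  have hA : ((11 / 10) ^+ 8) ^+ e = ((11 / 10) ^+ e) ^+ 8 :> R by rewrite -!exprM mulnC.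
  rewrite [(2 / _) ^+ e]exprMn exprVn hA -hB.
  have A0 : (11 / 10 : R) ^+ e != 0 by rewrite expf_neq0 //; apply/eqP; lra.
  have B0 : Num.sqrt 2 ^+ i != 0 :> R by rewrite expf_neq0 // sqrtr_eq0; lra.
  move: (_ ^+ e) (_ ^+ i) A0 B0 (2 ^+ e) (2 ^+ mu) (_ + _)%:R => A B A0 B0 p w c.
  by field; rewrite A0.
rewrite -mulr_sumr.
have f0 e : 0 <= f e by rewrite /f mulr_ge0 // exprn_ge0 // divr_ge0 // exprn_ge0 //; lra.
have h := le_trans (sum_sub_ord_le mu_le f0) (sum_linear_geometric_le R _).
apply: (@le_trans _ _ (2 ^+ mu * (105 / 8 ^+ 8) * 640)).
  by rewrite ler_wpM2l // !mulr_ge0 ?exprn_ge0 // invr_ge0 exprn_ge0.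
have c1 : 105 / 8 ^+ 8 * 640 <= 1 / 32 :> R.
  by rewrite mulrAC ler_pdivrMr ?exprn_gt0 //; lra.
have w0 : 0 <= 2 ^+ mu :> R by apply: exprn_ge0.
rewrite -mulrA; apply: le_trans (ler_wpM2l w0 c1) _.
by move: mu2; move: (2 ^+ mu) => w; lra.
Qed.

(** Blocks are cut from the sequences restricted to [U], which is harmless because [y] vanishes
    elsewhere and a prefix restricts to a prefix. Adding one deviation [D i <= 9 * growth R kap i]
    per scale costs [5 * 9 = 45] times the top growth. *)
Lemma partial_colouring_orders : exists y : T -> int,
  [/\ forall x, y x \in [:: -1; 0; 1],
      forall x, y x != 0 -> x \in U,
      (#|U| < 16 * #|[set x | y x != 0]|)%N
    & forall k t, `|\sum_(x <- take t (s k)) y x|%:~R <= 45 * growth R kap mu].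
Proof.
have sub i k j : subseq (block i k j) [seq x <- s k | x \in U].
  exact: subseq_trans (take_subseq _ _) (drop_subseq _ _).
have [||//||y [y1 yU yc yb]] := @partial_colouring R T J U
   (fun p => block (tag p) (tagged p).1 (tagged p).2) (fun p => D (tag p))
   (fun p => bits (tag p)) _ _ _ _ U_gt2 kraft cost.
- by move=> p; apply: subseq_uniq (sub _ _ _) _; rewrite filter_uniq.
- by move=> p x /(mem_subseq (sub _ _ _)); rewrite mem_filter => /andP[].
- by move=> p; rewrite /bits addnS.
exists y; split => // k t.
have -> : \sum_(x <- take t (s k)) y x = \sum_(x <- [seq x <- take t (s k) | x \in U]) y x.
  rewrite big_filter [RHS]big_mkcond; apply: eq_bigr => x _.
  by case: ifPn => // xU; apply/eqP/negPn; apply: contra xU; apply: yU.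
rewrite filter_take.
have tle : (count (mem U) (take t (s k)) <= 2 ^ mu)%N.
  apply: leq_trans U_le; rewrite -size_filter -(card_uniqP _) ?filter_uniq ?take_uniq //.
  by apply/subset_leq_card/subsetP => x; rewrite mem_filter => /andP[].
have := @prefix_dyadic T y [seq x <- s k | x \in U] (fun i => (D i)%:Z) mu _ _ tle.
move=> /(_ _) h; rewrite -(ler_int R) in h.
apply: le_trans (h _) _.
  move=> i j imu jlt; have i1 : (i < mu.+1)%N by [].
  exact: (yb (@Tagged _ (Ordinal i1) (fun i : 'I_mu.+1 => (I * 'I_(2 ^ (mu - i)))%type) (k, Ordinal jlt))).
apply: (@le_trans _ _ (\sum_(i < mu.+1) 9 * growth R kap i)).
  by rewrite rmorph_sum; apply: ler_sum => i _; apply: D_le.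
by rewrite -mulr_sumr; have := sum_growth_le R mu_le; lra.
Qed.

End Step.

(** * Iteration to a full colouring *)

Lemma expn_up_log_le m : (0 < m)%N -> (2 ^ up_log 2 m <= 2 * m)%N.
Proof.
case: (ltnP 1 m) => [m1 _|]; last by case: m => [|[|]].
have := up_log_gtn (isT : (1 < 2)%N) m1; case: (up_log 2 m) => [|mu] /=; first by lia.
by rewrite expnS leq_mul2l => /ltnW ->.
Qed.

(* The factor [1 + m / (3 * 2 ^ mu)] makes the bound decrease enough when [m]
   drops by 1/16 without changing [mu]. *)
Definition orders_bound (R : realType) (kap m : nat) : R :=
  let mu := up_log 2 m in 4320 * growth R kap mu * (1 + m%:R / (3 * 2 ^+ mu)).

Lemma orders_bound_ge (R : realType) kap m : 4320 <= orders_bound R kap m.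
Proof.
rewrite /orders_bound; set mu := up_log 2 m.
have g1 := growth_ge1 R kap mu.
have f0 : 0 <= m%:R / (3 * 2 ^+ mu) :> R by rewrite divr_ge0 ?mulr_ge0 ?exprn_ge0.
have g0 : 0 <= growth R kap mu by lra.
have := mulr_ge0 g0 f0; move: (growth _ _ _) (_ / _) g1 => g f g1 gf.
by lra.
Qed.

Lemma orders_bound_le (R : realType) kap m : (m <= 2 ^ kap)%N ->
  orders_bound R kap m <= 5760 * growth R kap (up_log 2 m).
Proof.
move=> mk; rewrite /orders_bound; set mu := up_log 2 m.
have g1 := growth_ge1 R kap mu.
have f1 : m%:R / (3 * 2 ^+ mu) <= 1 / 3 :> R.
  rewrite ler_pdivrMr ?mulr_gt0 ?exprn_gt0 //.
  have : m%:R <= 2 ^+ mu :> R by rewrite -natrX ler_nat up_logP.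
  by lra.
have g0 : 0 <= growth R kap mu by lra.
have h := ler_wpM2l g0 f1; move: (growth _ _ _) (_ / _) h => g f h; lra.
Qed.

(** If [up_log] drops, growth shrinks by 4/5 and [45 + 5760 * 4 / 5 <= 4320 * (1 + 1 / 6)].
    Otherwise the linear factor loses at least [(m / 16) / (3 * 2 ^ mu) >= 1 / 96], and
    [4320 / 96 = 45]. *)
Lemma orders_bound_step (R : realType) kap m m' : (2 < m <= 2 ^ kap)%N ->
  (16 * m' < 15 * m)%N ->
  45 * growth R kap (up_log 2 m) + orders_bound R kap m' <= orders_bound R kap m.
Proof.
case/andP=> m2 mk mm'.
have [le_mu|] := leqP (up_log 2 m) (up_log 2 m'); last first.
  move=> lt_mu; have := @orders_bound_le R kap m'.
  have mu_k : (up_log 2 m <= kap)%N by apply: up_log_min.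
  move=> /(_ _) h.
  have {}h : orders_bound R kap m' <= 5760 * growth R kap (up_log 2 m') by apply: h; lia.
  have gle : growth R kap (up_log 2 m') <= 4 / 5 * growth R kap (up_log 2 m).
    case e : (up_log 2 m) lt_mu mu_k => [//|mu]; rewrite ltnS => le1 le2.
    by apply: le_trans (growthS R le2); apply: growth_le; rewrite le1 ltnW.
  have := growth_ge1 R kap (up_log 2 m).
  have : 1 / 6 <= m%:R / (3 * 2 ^+ up_log 2 m) :> R.
    rewrite ler_pdivlMr ?mulr_gt0 ?exprn_gt0 //.
    have : 2 ^+ up_log 2 m <= 2 * m%:R :> R.
      by rewrite -natrX -natrM ler_nat expn_up_log_le //; lia.
    by lra.
  rewrite {2}/orders_bound; move: (growth _ _ (up_log 2 m)) (m%:R / _) gle => g f gle f6 g1.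
  have := ler_wpM2l (_ : 0 <= g) f6; move=> /(_ ltac:(lra)) gf.
  by lra.
have e : up_log 2 m' = up_log 2 m.
  by apply/eqP; rewrite eqn_leq le_mu andbT; apply: leq_up_log; lia.
rewrite /orders_bound e; set mu := up_log 2 m.
have g1 := growth_ge1 R kap mu.
have : m%:R / (3 * 2 ^+ mu) - m'%:R / (3 * 2 ^+ mu) >= 1 / 96 :> R.
  rewrite -mulrBl ler_pdivlMr ?mulr_gt0 ?exprn_gt0 //.
  have h1 : 2 ^+ mu <= 2 * m%:R :> R.
    by rewrite -natrX -natrM ler_nat expn_up_log_le //; lia.
  have h2 : 16 * m'%:R <= 15 * m%:R :> R by rewrite -!natrM ler_nat ltnW.
  by lra.
move: (growth _ _ _) g1 (m%:R / _) (m'%:R / _) => g g1 f f' ff.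
have := ler_wpM2l (_ : 0 <= g) ff; move=> /(_ ltac:(lra)) gf.
by lra.
Qed.

(** Partial colourings are repeated on the set [V] of elements still coloured 0, smaller than 15/16
    of [U]; [orders_bound_step] absorbs each round. Once at most two elements remain, they all
    receive +1. *)
Lemma orders_colouring (R : realType) (T I : finType) (s : I -> seq T) kap :
  (forall k, uniq (s k)) -> (#|I| <= 2 ^ kap)%N -> forall U : {set T}, (#|U| <= 2 ^ kap)%N ->
  exists y : T -> int,
  [/\ forall x, x \in U -> `|y x| = 1, forall x, x \notin U -> y x = 0
    & forall k t, `|\sum_(x <- take t (s k)) y x|%:~R <= orders_bound R kap #|U|].
Proof.
move=> s_uniq I_le U; move: {2}#|U| (leqnn #|U|) => n.
elim: n U => [|n IH] U Un Uk.
  exists (fun=> 0); split => // [x xU|k t].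
    by move: Un; rewrite leqn0 cards_eq0 => /eqP U0; rewrite U0 inE in xU.
  by rewrite big1 // normr0; have := orders_bound_ge R kap #|U|; lra.
have [U2|U2] := leqP #|U| 2.
  exists (fun x => (x \in U)%:R); split => [x ->|x /negbTE->|k t] //.
  apply: le_trans (orders_bound_ge _ _ _).
  have -> : \sum_(x <- take t (s k)) (x \in U)%:R = (size [seq x <- take t (s k) | x \in U])%:Z.
    by rewrite size_filter -sum1_count -natz natr_sum [RHS]big_mkcond; apply: eq_bigr => x _; case: ifP.
  apply: (@le_trans _ _ (2 : R)); last by lra.
  rewrite ger0_norm // (_ : 2 = 2%:~R) // ler_int lez_nat; apply: leq_trans U2.
  rewrite -(card_uniqP _) ?filter_uniq ?take_uniq //.
  by apply/subset_leq_card/subsetP => x; rewrite mem_filter => /andP[].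
have mu_k : (up_log 2 #|U| <= kap)%N by apply: up_log_min.
have [||y [y1 yU yc yb]] := @partial_colouring_orders R T I s kap (up_log 2 #|U|) U s_uniq I_le mu_k _ _ U2.
- by rewrite up_logP.
- by rewrite expn_up_log_le //; lia.
pose V := [set x in U | y x == 0].
have UV : #|U| = (#|V| + #|[set x | y x != 0]|)%N.
  rewrite -(cardsID V U); congr (_ + _)%N; apply: eq_card => x; rewrite !inE; first by case: (x \in U).
  by case: (boolP (y x == 0)) => [_|/yU ->] /=; rewrite ?andbT ?andbF // andNb.
have [|| z [z1 z0 zb]] := IH V; [lia|lia|].
exists (fun x => y x + z x); split => [x xU|x xU|k t].
- have [yx0|yx0] := eqVneq (y x) 0; first by rewrite yx0 add0r z1 // inE xU yx0 eqxx.
  by rewrite z0 ?inE ?(negbTE yx0) ?andbF // addr0; move: (y1 x) yx0; rewrite !inE => /or3P[]/eqP->.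
- rewrite z0 ?inE ?(negbTE xU) // addr0; apply/eqP/negPn; apply: contra xU; exact: yU.
- rewrite big_split /=; apply: (@le_trans _ _ (45 * growth R kap (up_log 2 #|U|) + orders_bound R kap #|V|)); last first.
    by apply: orders_bound_step; lia.
  apply: (@le_trans _ _ (`|\sum_(x <- take t (s k)) y x|%:~R + `|\sum_(x <- take t (s k)) z x|%:~R)).
    by rewrite -intrD ler_int ler_normD.
  by apply: lerD.
Qed.

(** * Colourings balanced on cosets *)

Lemma eqn_mulDr m u v u' v' : (v < m)%N -> (v' < m)%N ->
  (u * m + v == u' * m + v')%N = (u == u') && (v == v').
Proof.
move=> vm vm'; have m0 : (0 < m)%N by apply: leq_ltn_trans vm.
apply/eqP/andP => [e|[/eqP-> /eqP-> //]].
have := congr1 (divn^~ m) e; have := congr1 (modn^~ m) e.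
by rewrite /= !modnMDl !divnMDl // !modn_small // !divn_small // !addn0 => -> ->.
Qed.

Fixpoint digit_rev (p a x : nat) : nat :=
  if a is a'.+1 then (x %% p * p ^ a' + digit_rev p a' (x %/ p))%N else 0%N.

Lemma digit_rev_lt p a x : (0 < p)%N -> (digit_rev p a x < p ^ a)%N.
Proof.
move=> p0; elim: a x => [//|a IH] x /=.
have := ltn_pmod x p0; have := IH (x %/ p)%N; rewrite expnS; move: (p ^ a)%N => q.
nia.
Qed.

(** A class modulo [p ^ b] fixes the low [b] digits, which reversal turns into the top [b] digits;
    it thus becomes an aligned interval of length [p ^ (a - b)]. *)
Lemma digit_rev_class p a b x c : (0 < p)%N -> (b <= a)%N -> (x < p ^ a)%N -> (c < p ^ a)%N ->
  (x == c %[mod p ^ b]) = (digit_rev p a x %/ p ^ (a - b) == digit_rev p a c %/ p ^ (a - b))%N.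
Proof.
move=> p0; elim: a b x c => [|a IH] [|b] x c //=; rewrite ?expn0 ?modn1 ?eqxx //.
  have lt y : (y %% p * p ^ a + digit_rev p a (y %/ p) < p ^ a.+1)%N := @digit_rev_lt p a.+1 y p0.
  by move=> _ _ _; rewrite subn0 (divn_small (lt x)) (divn_small (lt c)) eqxx.
rewrite ltnS subSS => ba xa ca.
have xa' : (x %/ p < p ^ a)%N by rewrite ltn_divLR // mulnC -expnS.
have ca' : (c %/ p < p ^ a)%N by rewrite ltn_divLR // mulnC -expnS.
have L0 : (0 < p ^ (a - b))%N by rewrite expn_gt0 p0.
have pa : (p ^ a = p ^ b * p ^ (a - b))%N by rewrite -expnD subnKC.
have divE y : (digit_rev p a.+1 y %/ p ^ (a - b) =
    y %% p * p ^ b + digit_rev p a (y %/ p) %/ p ^ (a - b))%N.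
  by rewrite /= pa mulnA divnMDl.
have := divE x; have := divE c => /= -> ->.
have lt y : (digit_rev p a y %/ p ^ (a - b) < p ^ b)%N.
  by rewrite ltn_divLR // -pa digit_rev_lt.
have modE y : (y %% p ^ b.+1 = (y %/ p) %% p ^ b * p + y %% p)%N.
  rewrite {1}(divn_eq y p) {1}(divn_eq (y %/ p) (p ^ b)) mulnDl -addnA -mulnA -expnSr.
  rewrite modnMDl modn_small // expnSr.
  have := ltn_pmod y p0; have := ltn_pmod (y %/ p)%N (_ : 0 < p ^ b)%N.
  by rewrite expn_gt0 p0 => /(_ isT); nia.
by rewrite !modE !eqn_mulDr ?ltn_pmod // -IH // andbC.
Qed.

Definition alt (v : nat) : int := if odd v then -1 else 1.

(** From an even start, positions [2i] and [2i+1] carry the same [eps] with opposite signs and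
    cancel; only a last position of an odd-length interval survives. *)
Lemma alt_sum_even (eps : nat -> int) u L :
  \sum_(i < L) alt (2 * u + i) * eps (2 * u + i)./2 =
  if odd L then eps (2 * u + L.-1)./2 else 0.
Proof.
elim/ltn_ind: L => -[|[|L]] IH; first by rewrite big_ord0.
  by rewrite big_ord1 /= addn0 /alt oddM /= mul1r.
rewrite !big_ord_recr /= IH; last by lia.
rewrite negbK; have -> : alt (2 * u + L.+1) = - alt (2 * u + L).
  by rewrite /alt addnS /=; case: odd.
case: (boolP (odd L)) => oL.
  have -> : alt (2 * u + L) = -1 by rewrite /alt oddD oddM oL.
  have -> : (2 * u + L.-1)./2 = (2 * u + L)./2 by lia.
  by ring.
have -> : alt (2 * u + L) = 1 by rewrite /alt oddD oddM (negbTE oL).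
have -> : (2 * u + L.+1)./2 = (2 * u + L)./2 by lia.
by ring.
Qed.

(** Alignment prevents both ends from being unpaired: an odd start [j * L] forces [L] odd, so after
    the first position an even number remains, starting at an even place. *)
Lemma alt_sum_interval (L j : nat) : exists z : option (nat * bool), forall eps : nat -> int,
  \sum_(i < L) alt (j * L + i) * eps (j * L + i)./2 =
  if z is Some (b, t) then (if t then -1 else 1) * eps b else 0.
Proof.
case: (boolP (odd (j * L))) => [jo|je].
  case: L jo => [|L jo]; first by rewrite muln0.
  have Lo : odd L = false by move: jo; rewrite oddM oddS => /andP[_ /negbTE].
  exists (Some ((j * L.+1)./2, true)) => eps; rewrite big_ord_recl addn0 /alt jo.
  have -> : (\sum_(i < L) alt (j * L.+1 + lift ord0 i) * eps (j * L.+1 + lift ord0 i)%N./2) = 0.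
    have e : (j * L.+1).+1 = (2 * (j * L.+1).+1./2)%N by lia.
    under eq_bigr => i _ do rewrite lift0 addnS -addSn e.
    by rewrite alt_sum_even Lo.
  by rewrite addr0.
have e : (j * L)%N = (2 * (j * L)./2)%N by lia.
exists (if odd L then Some ((2 * (j * L)./2 + L.-1)./2, false) else None) => eps.
by rewrite e alt_sum_even -e; case: odd => //; rewrite mul1r -e.
Qed.

(* For every choice [eps] of signs of the boxes, the coset sums of
   [sg (ty x) * eps (box x)] vanish or reduce to a single term. *)
Definition balanced (r : nat) (B Ty : finType) (box : nat -> B) (ty : nat -> Ty)
    (sg : Ty -> int) : Prop :=
  [/\ forall x y, (x < r)%N -> (y < r)%N -> box x = box y -> ty x = ty y -> x = y,
      forall t, `|sg t| = 1
    & forall g a, (g %| r)%N -> exists z : option (B * Ty), forall eps : B -> int,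
      \sum_(x < r | x == a %[mod g]) sg (ty x) * eps (box x) =
      if z is Some (b, t) then sg t * eps b else 0].

Lemma sum_ord_interval (V : nmodType) (F : nat -> V) q L j : (0 < L)%N -> (j.+1 * L <= q)%N ->
  \sum_(v < q | (v %/ L == j)%N) F v = \sum_(i < L) F (j * L + i)%N.
Proof.
move=> L0 jq.
rewrite -(big_mkord (fun v => (v %/ L == j)%N)) (@big_cat_nat _ _ _ (j * L)%N) //=; last by lia.
rewrite big_nat_cond big1 ?add0r; last first.
  by move=> v /andP[/andP[_ lt] /eqP e]; move: lt; rewrite -{1}e; have := leq_trunc_div v L; lia.
rewrite (@big_cat_nat _ _ _ (j * L + L)%N) ?leq_addr //=; last by lia.
rewrite [X in _ + X]big_nat_cond [X in _ + X]big1 ?addr0; last first.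
  move=> v /andP[/andP[le _] /eqP e]; have := ltn_ceil v L0; rewrite e; lia.
rewrite -{1}[(j * L)%N]add0n big_addn addKn big_mkord.
apply: eq_big => [i|i _]; last by rewrite addnC.
by rewrite addnC divnMDl // divn_small ?addn0 ?eqxx.
Qed.

Lemma balanced_primepow p k : prime p -> let q := (p ^ k)%N in
  exists box ty, @balanced q 'I_((q.-1)./2.+1) bool box ty (fun t => if t then -1 else 1).
Proof.
move=> pp q; have p0 := prime_gt0 pp.
have q0 : (0 < q)%N by rewrite expn_gt0 p0.
pose rho := digit_rev p k; have rho_lt x : (rho x < q)%N by apply: digit_rev_lt.
have rho_inj x y : (x < q)%N -> (y < q)%N -> rho x = rho y -> x = y.
  move=> xq yq e; have := @digit_rev_class p k k x y p0 (leqnn k) xq yq.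
  by rewrite subnn !divn1 -/rho e eqxx !modn_small // => /eqP.
exists (fun x => inord (rho x)./2), (fun x => odd (rho x)).
have val_box x : val (inord (rho x)./2 : 'I_((q.-1)./2.+1)) = (rho x)./2.
  by rewrite /= inordK //; have := rho_lt x; lia.
split => [x y xq yq /(congr1 val)|t|g a].
- rewrite !val_box => e1 e2; apply: rho_inj => //.
  by rewrite -(odd_double_half (rho x)) -(odd_double_half (rho y)) e1 e2.
- by case: t.
case/(dvdn_pfactor _ _ pp) => b bk ->.
set L := (p ^ (k - b))%N; have L0 : (0 < L)%N by rewrite expn_gt0 p0.
have qL : q = (p ^ b * L)%N by rewrite -expnD subnKC.
set c := (a %% q)%N; have cq : (c < q)%N by rewrite ltn_pmod.
set j := (rho c %/ L)%N.
have jlt : (j < p ^ b)%N by rewrite ltn_divLR // -qL.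
have [z zP] := alt_sum_interval L j.
have sumE (eps : 'I_((q.-1)./2.+1) -> int) :
    \sum_(x < q | x == a %[mod p ^ b]) (if odd (rho x) then -1 else 1) * eps (inord (rho x)./2) =
    \sum_(i < L) alt (j * L + i) * eps (inord (j * L + i)./2).
  pose h (x : 'I_q) : 'I_q := Ordinal (rho_lt x).
  have h_inj : injective h by move=> x y /(congr1 val) /= /rho_inj e; apply: val_inj; apply: e.
  rewrite -(@sum_ord_interval _ (fun v => alt v * eps (inord v./2)) q) //; last first.
    by rewrite qL leq_mul2r jlt orbT.
  rewrite [RHS](reindex_inj h_inj) /=; apply: eq_bigl => x.
  rewrite -digit_rev_class // /c modn_dvdm //.
  by rewrite qL dvdn_mulr.
case: z zP => [[b' t]|] zP.
  exists (Some (inord b', t)) => eps; rewrite sumE.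
  exact: (zP (fun v => eps (inord v))).
exists None => eps; rewrite sumE; exact: (zP (fun v => eps (inord v))).
Qed.

(** By the Chinese remainder theorem a class modulo [g] is a product of classes modulo [gcdn g r1]
    and [gcdn g r2]. The double sum collapses one coordinate at a time, with the other box
    coordinate held fixed inside [eps]. *)
Lemma balanced_mul r1 r2 (B1 B2 Ty1 Ty2 : finType) box1 box2 ty1 ty2 sg1 sg2 :
  (0 < r1)%N -> (0 < r2)%N -> coprime r1 r2 ->
  @balanced r1 B1 Ty1 box1 ty1 sg1 -> @balanced r2 B2 Ty2 box2 ty2 sg2 ->
  @balanced (r1 * r2) (B1 * B2)%type (Ty1 * Ty2)%type
    (fun x => (box1 (x %% r1)%N, box2 (x %% r2)%N))
    (fun x => (ty1 (x %% r1)%N, ty2 (x %% r2)%N))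
    (fun t => sg1 t.1 * sg2 t.2).
Proof.
move=> r1p r2p co [inj1 s1 z1] [inj2 s2 z2]; split => [x y xr yr [b1 b2] [t1 t2]|t|g a gr].
- have e1 := inj1 _ _ (ltn_pmod x r1p) (ltn_pmod y r1p) b1 t1.
  have e2 := inj2 _ _ (ltn_pmod x r2p) (ltn_pmod y r2p) b2 t2.
  have := chinese_remainder co x y; rewrite e1 e2 !eqxx /= !modn_small // => /eqP //.
- by rewrite normrM s1 s2 mulr1.
set g1 := gcdn g r1; set g2 := gcdn g r2.
have cog : coprime g1 g2.
  by apply: coprime_dvdl (dvdn_gcdr g r1) _; apply: coprime_dvdr (dvdn_gcdr g r2) _.
have gE : g = (g1 * g2)%N.
  apply/eqP; rewrite eqn_dvd Gauss_dvd // !dvdn_gcdl !andbT.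
  rewrite muln_gcdr dvdn_gcd dvdn_mull // /g1 muln_gcdl dvdn_gcd gr andbT.
  by rewrite dvdn_mulr.
have [w1 w1P] := z1 g1 a (dvdn_gcdr _ _).
have [w2 w2P] := z2 g2 a (dvdn_gcdr _ _).
pose h (x : 'I_(r1 * r2)) : 'I_r1 * 'I_r2 :=
  (Ordinal (ltn_pmod x r1p), Ordinal (ltn_pmod x r2p)).
have h_bij : bijective h.
  apply: inj_card_bij; last by rewrite card_prod !card_ord.
  move=> x y [e1 e2]; apply: val_inj => /=.
  by have := chinese_remainder co x y; rewrite e1 e2 !eqxx /= !modn_small // => /eqP.
have sumE (eps : B1 * B2 -> int) :
    \sum_(x < r1 * r2 | x == a %[mod g]) (sg1 (ty1 (x %% r1)%N) * sg2 (ty2 (x %% r2)%N)) *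
       eps (box1 (x %% r1)%N, box2 (x %% r2)%N) =
    \sum_(x1 < r1 | x1 == a %[mod g1]) sg1 (ty1 x1) *
      \sum_(x2 < r2 | x2 == a %[mod g2]) sg2 (ty2 x2) * eps (box1 x1, box2 x2).
  under [RHS]eq_bigr => x1 _ do rewrite mulr_sumr.
  rewrite pair_big /= [RHS](reindex h) /=; last exact: onW_bij.
  apply: eq_big => [x|x _]; last by rewrite mulrA.
  rewrite !modn_dvdm ?dvdn_gcdr // gE.
  exact: chinese_remainder.
case: w2 w2P => [[b2 t2]|] w2P.
  exists (if w1 is Some (b1, t1) then Some ((b1, b2), (t1, t2)) else None) => eps.
  rewrite sumE.
  under eq_bigr => x1 _ do rewrite (w2P (fun b => eps (box1 x1, b))) mulrCA.
  rewrite -mulr_sumr (w1P (fun b => eps (b, b2))).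
  by case: w1 {w1P} => [[b1 t1]|]; rewrite ?mulr0 //= mulrCA mulrA.
exists None => eps; rewrite sumE big1 // => x1 _.
by rewrite (w2P (fun b => eps (box1 x1, b))) mulr0.
Qed.

(** Prime powers are split off one by one. A power [q] contributes [h = (q.-1)./2.+1] boxes, and
    [2 * h ^ 2 <= q ^ 2] saves a factor [Num.sqrt 2] in the box count for each prime. *)
Lemma exists_balanced r : (0 < r)%N -> exists (B Ty : finType) box ty sg,
  [/\ @balanced r B Ty box ty sg, (#|B| ^ 2 * 2 ^ omega r <= r ^ 2)%N
    & (#|Ty| <= 2 ^ omega r)%N].
Proof.
elim/ltn_ind: r => r IH r0.
have [r1|r1] := leqP r 1.
  have -> : r = 1%N by lia.
  exists unit, unit, (fun=> tt), (fun=> tt), (fun=> 1); rewrite !card_unit; split => //.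
  split => [[|//] [|//]|t|g a] //.
  rewrite dvdn1 => /eqP ->; exists (Some (tt, tt)) => eps.
  by rewrite (eq_bigl predT) ?big_ord1 // => x; rewrite !modn1.
set p := pdiv r; have pp : prime p by apply: pdiv_prime.
have rE : (r`_p^' * r`_p)%N = r by rewrite mulnC partnC.
set q := (r`_p)%N; set r' := (r`_p^')%N; rewrite -/q -/r' in rE.
have qE : q = (p ^ logn p r)%N by rewrite /q p_part.
have lg : (0 < logn p r)%N by rewrite logn_gt0 mem_primes pp r0 pdiv_dvd.
have q1 : (1 < q)%N by rewrite qE -(exp1n (logn p r)) ltn_exp2r // prime_gt1.
have r'0 : (0 < r')%N by apply: part_gt0.
have omE : omega r = (omega r').+1.
  rewrite /omega /r' primes_part size_filter -(count_predC (pred1 p) (primes r)).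
  rewrite (count_uniq_mem p (primes_uniq r)) mem_primes pp r0 pdiv_dvd add1n.
  by congr _.+1; apply: eq_count => x; rewrite !inE.
have [|//|B [Ty [box [ty [sg [bal cB cT]]]]]] := IH r'.
  by rewrite -rE ltn_Pmulr.
have /= := balanced_primepow (logn p r) pp; rewrite -qE => -[box2 [ty2 bal2]].
have co : coprime r' q by rewrite coprime_sym coprime_partC.
exists (B * 'I_((q.-1)./2.+1))%type, (Ty * bool)%type.
have := balanced_mul r'0 (ltnW q1) co bal bal2; rewrite rE => bal12.
do 3! eexists; split; first exact: bal12.
  rewrite card_prod card_ord omE -rE !expnMn (expnS 2).
  have : (2 * (q.-1)./2.+1 ^ 2 <= q ^ 2)%N.
    have : (2 * (q.-1)./2.+1 <= q.+1)%N by lia.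
    (* From [2 * h <= q + 1] one needs [(q + 1) ^ 2 <= 2 * q ^ 2], which fails at [q = 2]; there
       [h = 1]. *)
    have [q3|q3] := ltnP 2 q; first by move: ((q.-1)./2.+1) => h h1; nia.
    by have -> : q = 2 by lia.
  move=> h2; apply: leq_trans (leq_mul cB h2); apply: eq_leq.
  by ring.
by rewrite card_prod card_bool omE expnS mulnC leq_mul2l.
Qed.

(** * Progressions in cyclic groups *)

Lemma dvdn_mul_gcd n d k : (0 < n)%N -> (n %| k * d)%N = (n %/ gcdn d n %| k)%N.
Proof.
move=> n0; set g := gcdn d n; have g0 : (0 < g)%N by rewrite gcdn_gt0 n0 orbT.
have [d0|d0] := posnP d.
  by rewrite d0 muln0 dvdn0 /g d0 gcd0n divnn n0 dvd1n.
have co : coprime (n %/ g) (d %/ g).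
  by rewrite /coprime -(eqn_pmul2r g0) muln_gcdl !divnK ?dvdn_gcdl ?dvdn_gcdr // mul1n gcdnC.
have nE : n = (n %/ g * g)%N by rewrite divnK ?dvdn_gcdr.
have dE : d = (d %/ g * g)%N by rewrite divnK ?dvdn_gcdl.
by rewrite {1}nE {1}dE mulnA dvdn_pmul2r // Gauss_dvdl.
Qed.

Lemma ap_inj n a d k k' : (0 < n)%N ->
  (k < n %/ gcdn d n)%N -> (k' < n %/ gcdn d n)%N ->
  a + k * d = a + k' * d %[mod n] -> k = k'.
Proof.
move=> n0; wlog le : k k' / (k <= k')%N => [W|] hk hk' e.
  by case: (leqP k k') => [/W|/ltnW/W] h; [apply: h|apply/esym/h].
move/eqP: e; rewrite eq_sym eqn_mod_dvd; last by rewrite leq_add2l leq_mul2r le orbT.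
rewrite subnDl -mulnBl dvdn_mul_gcd // => /dvdn_leq; lia.
Qed.

Lemma ap_surj n a d x : (0 < n)%N -> a = x %[mod gcdn d n] ->
  exists2 k, (k < n %/ gcdn d n)%N & a + k * d = x %[mod n].
Proof.
move=> n0 axg; set g := gcdn d n; have g0 : (0 < g)%N by rewrite gcdn_gt0 n0 orbT.
have gn : (g %| n)%N by apply: dvdn_gcdr.
have o0 : (0 < n %/ g)%N by rewrite divn_gt0 // dvdn_leq.
have [d0|d0] := posnP d.
  exists 0%N => //; rewrite mul0n addn0; move: axg; by rewrite d0 gcd0n.
have [km kn kE _] := egcdnP n d0; rewrite -/g in kE.
(* A natural number congruent to [x - a] modulo [n]. *)
pose y := (x + (n * a - a))%N.
have na : (a <= n * a)%N by rewrite leq_pmull.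
have yE : (a + y = x + n * a)%N by rewrite /y; move: (n * a)%N na => b; lia.
have gy : (g %| y)%N.
  have : (a + y == a %[mod g])%N.
    by rewrite yE mulnC -modnDmr -modnMmr (eqP gn) muln0 mod0n addn0 axg.
  by rewrite eqn_mod_dvd ?leq_addr // addKn.
exists ((km * (y %/ g)) %% (n %/ g))%N; first by rewrite ltn_pmod.
have e : (a + km * (y %/ g) * d = x %[mod n])%N.
  have -> : (km * (y %/ g) * d = y %/ g * kn * n + y)%N.
    by rewrite mulnAC kE mulnDl [(g * _)%N]mulnC divnK //; congr (_ + _)%N; ring.
  by rewrite addnCA modnMDl yE mulnC addnC modnMDl.
rewrite -e; apply/eqP; rewrite eq_sym {1}(divn_eq (km * (y %/ g)) (n %/ g)) mulnDl addnCA.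
rewrite (_ : _ * (n %/ g) * d = (km * (y %/ g) %/ (n %/ g)) * (d %/ g) * n)%N ?modnMDl //.
have e2 : (n %/ g * d = d %/ g * n)%N by rewrite mulnC muln_divCA_gcd mulnC.
by rewrite -mulnA e2 mulnA.
Qed.

(** The bound on [l] makes the terms distinct, so the sum over the set is the sum over the index. *)
Lemma col_sum_AP n (chi : {ffun 'I_n -> bool}) (a d : 'I_n) l (f : nat -> int) :
  (forall x : 'I_n, f x = if chi x then 1 else -1) -> (l <= n %/ gcdn d n)%N ->
  col_sum chi (AP a d l) = \sum_(k < l) f ((a + k * d) %% n)%N.
Proof.
move=> fE ln; have n0 : (0 < n)%N by apply: leq_ltn_trans (ltn_ord a).
pose h (k : 'I_l) : 'I_n := Ordinal (ltn_pmod (a + k * d) n0).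
have h_inj : injective h.
  move=> k k' /(congr1 val) /= e; apply: val_inj => /=.
  by apply: (@ap_inj n a d) => //; apply: leq_trans ln.
have -> : AP a d l = [set h k | k : 'I_l].
  apply/setP => x; rewrite inE; apply/existsP/imsetP => -[k].
    by move/eqP => e; exists k => //; apply: val_inj.
  by move=> _ ->; exists k.
rewrite /col_sum big_imset /=; last by move=> ? ? _ _; apply: h_inj.
by apply: eq_bigr => k _; rewrite -fE.
Qed.

Lemma sum_coset (V : nmodType) (f : nat -> V) r a d : (0 < r)%N ->
  \sum_(k < r %/ gcdn d r) f ((a + k * d) %% r)%N =
  \sum_(x < r | x == a %[mod gcdn d r]) f x.
Proof.
move=> r0; pose h (k : 'I_(r %/ gcdn d r)) : 'I_r := Ordinal (ltn_pmod (a + k * d) r0).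
have h_inj : {in predT &, injective h}.
  move=> k k' _ _ /(congr1 val) /= e; apply: val_inj => /=.
  by apply: (@ap_inj r a d).
rewrite -(big_imset (fun x : 'I_r => f x) h_inj); apply: eq_bigl => x.
apply/imsetP/eqP => [[k _ ->] /=|e].
  rewrite modn_dvdm ?dvdn_gcdr // -modnDmr -modnMmr (eqP (dvdn_gcdl d r)).
  by rewrite muln0 mod0n addn0.
have [k ko kx] := ap_surj r0 (esym e); exists (Ordinal ko) => //; apply: val_inj => /=.
by rewrite kx modn_small.
Qed.

Lemma sum_periodic (F : nat -> int) o w l : (forall k, F (k + o)%N = F k) ->
  \sum_(k < w * o + l) F k = w%:R * (\sum_(k < o) F k) + \sum_(k < l) F k.
Proof.
move=> per; elim: w => [|w IH]; first by rewrite mul0r add0r.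
rewrite mulSn -addnA big_split_ord /= -natr1 mulrDl mul1r.
under [X in _ + X]eq_bigr => i _ do rewrite addnC per.
by rewrite IH; ring.
Qed.

(* Lists Z_r coset after coset of the subgroup generated by [d], each in steps of [d]. *)
Definition coset_enum (r d i : nat) : nat :=
  let o := (r %/ gcdn d r)%N in ((i %/ o + i %% o * d) %% r)%N.

Lemma coset_enumE r d c i : (i < r %/ gcdn d r)%N ->
  coset_enum r d (c * (r %/ gcdn d r) + i) = ((c + i * d) %% r)%N.
Proof.
move=> io; rewrite /coset_enum modnMDl (modn_small io) divnMDl; last by apply: leq_ltn_trans io.
by rewrite (divn_small io) addn0.
Qed.

Lemma coset_enum_inj r d i j : (0 < r)%N -> (i < r)%N -> (j < r)%N ->
  coset_enum r d i = coset_enum r d j -> i = j.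
Proof.
move=> r0 ir jr; set g := gcdn d r; set o := (r %/ g)%N.
have g0 : (0 < g)%N by rewrite gcdn_gt0 r0 orbT.
have o0 : (0 < o)%N by rewrite divn_gt0 // dvdn_leq // dvdn_gcdr.
have rE : r = (g * o)%N by rewrite mulnC divnK // dvdn_gcdr.
have lt k : (k < r)%N -> (k %/ o < g)%N by rewrite {1}rE => h; rewrite ltn_divLR.
rewrite /coset_enum -/g -/o => e.
have modg k : (k < r)%N -> ((k %/ o + k %% o * d) %% r %% g = k %/ o)%N.
  move=> kr; rewrite modn_dvdm ?dvdn_gcdr // -modnDmr -modnMmr (eqP (dvdn_gcdl d r)).
  by rewrite muln0 mod0n addn0 modn_small // lt.
have q : (i %/ o = j %/ o)%N by rewrite -modg // e modg.
rewrite q in e; have := @ap_inj r _ d _ _ r0 (ltn_pmod i o0) (ltn_pmod j o0) e.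
by rewrite {2}(divn_eq i o) {2}(divn_eq j o) q => ->.
Qed.

(** * Colouring of Z_r with small coset and progression sums *)

Lemma growth_le_sqrt (R : realType) (r M w kap : nat) : (0 < M)%N -> (0 < r)%N ->
  (M ^ 2 * 2 ^ w <= r ^ 2)%N -> kap = up_log 2 (r * 2 ^ w) -> (M <= r * 2 ^ w)%N ->
  growth R kap (up_log 2 M) <= 2 * Num.sqrt r%:R.
Proof.
move=> M0 r0 h kE MK; set mu := up_log 2 M.
have mk : (mu <= kap)%N by rewrite kE; apply: leq_up_log.
have s0 : 0 <= Num.sqrt 2 :> R by apply: sqrtr_ge0.
have g0 : 0 <= growth R kap mu by have := growth_ge1 R kap mu; lra.
rewrite -(ler_pXn2r (n := 6)) ?nnegrE //; last by rewrite mulr_ge0 ?sqrtr_ge0.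
have -> : (2 * Num.sqrt r%:R : R) ^+ 6 = 64 * r%:R ^+ 3.
  rewrite exprMn (exprM (Num.sqrt _) 2 3) sqr_sqrtr //; congr (_ * _); ring.
have -> : growth R kap mu ^+ 6 = ((11 / 10) ^+ 6) ^+ (kap - mu) * 8 ^+ mu.
  rewrite /growth exprMn; congr (_ * _); first by rewrite -!exprM mulnC.
  rewrite -exprM (_ : (mu * 6 = 2 * (3 * mu))%N); last by lia.
  by rewrite exprM sqr_sqrtr // exprM; congr (_ ^+ _); ring.
(* Since [(11 / 10) ^+ 6 <= 2], the sixth power is at most [2 ^ kap * (2 ^ mu) ^ 2], hence at most
   [8 * r * (M ^ 2 * 2 ^ w)]. The saving in the number [M] of boxes cancels the factor [2 ^ w]
   coming from the number of sequences. *)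
apply: (@le_trans _ _ (2 ^+ (kap - mu) * 8 ^+ mu)).
  rewrite ler_wpM2r ?exprn_ge0 //; apply: lerXn2r; rewrite ?nnegrE ?exprn_ge0 //; lra.
have K0 : (0 < r * 2 ^ w)%N by rewrite muln_gt0 r0 expn_gt0.
have h1 := expn_up_log_le K0; rewrite -kE in h1.
have h2 := expn_up_log_le M0; rewrite -/mu in h2.
rewrite -!natrX -!natrM ler_nat.
have -> : (2 ^ (kap - mu) * 8 ^ mu = 2 ^ kap * (2 ^ mu) ^ 2)%N.
  rewrite -{2}(subnK mk) expnD (_ : 8 = 2 ^ 3)%N // -!expnM -!expnD; congr (2 ^ _)%N; lia.
apply: (@leq_trans (2 * (r * 2 ^ w) * (2 * M) ^ 2)%N).
  by apply: leq_mul => //; rewrite leq_exp2r.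
apply: (@leq_trans (8 * r * (M ^ 2 * 2 ^ w))%N); first by rewrite expnMn; apply: eq_leq; ring.
apply: leq_trans (leq_mul (leqnn _) h) _; rewrite (_ : _ * _ = 8 * r ^ 3)%N; last by ring.
by rewrite leq_mul2r orbT.
Qed.

Lemma cyclic_colouring (R : realType) r : (0 < r)%N -> exists psi : nat -> int,
  [/\ forall x, `|psi x| = 1,
      forall g a, (g %| r)%N -> `|\sum_(x < r | x == a %[mod g]) psi x| <= 1
    & forall a d l, (l <= r %/ gcdn d r)%N ->
      `|\sum_(k < l) psi ((a + k * d) %% r)%N|%:~R <=
        2 ^+ 16 * Num.sqrt r%:R * 2 ^+ omega r :> R].
Proof.
move=> r0; have [B [Ty [box [ty [sg [[inj sg1 bal] cB cT]]]]]] := exists_balanced r0.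
set w := omega r in cB cT *.
have B0 : (0 < #|B|)%N by apply/card_gt0P; exists (box 0%N).
have Br : (#|B| <= r)%N.
  by rewrite -(leq_exp2r _ _ (isT : (0 < 2)%N)); apply: leq_trans cB; rewrite leq_pmulr // expn_gt0.
have rK : (r <= r * 2 ^ w)%N by rewrite leq_pmulr // expn_gt0.
pose kap := up_log 2 (r * 2 ^ w).
pose E d := [seq coset_enum r d i | i <- iota 0 r].
(* One sequence of boxes for each difference and type. Within a fixed type a box determines its
   element, so the sequence has no repetition, and [psi] differs from [y] only by the constant sign
   of the type. *)
pose s (k : 'I_r * Ty) := [seq box x | x <- E k.1 & ty x == k.2].
have E_uniq d : uniq (E d).
  rewrite map_inj_in_uniq ?iota_uniq // => i j; rewrite !mem_iota /= add0n => ir jr.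
  exact: coset_enum_inj.
have E_lt d x : x \in E d -> (x < r)%N by case/mapP=> i _ ->; rewrite ltn_pmod.
have s_uniq k : uniq (s k).
  rewrite map_inj_in_uniq ?filter_uniq // => x y; rewrite !mem_filter.
  case/andP=> /eqP tx xE /andP[/eqP ty_ yE] e.
  by apply: (inj x y (E_lt _ _ xE) (E_lt _ _ yE) e); rewrite tx ty_.
have I_le : (#|{: 'I_r * Ty}| <= 2 ^ kap)%N.
  rewrite card_prod card_ord; apply: leq_trans (up_logP _ _) => //.
  by rewrite leq_mul2l cT orbT.
have [|y [y1 _ yb]] := orders_colouring R s_uniq I_le (U := setT).
  by rewrite cardsT; apply: leq_trans (up_logP _ _) => //; apply: leq_trans rK.
rewrite cardsT in yb.
pose psi x := sg (ty x) * y (box x).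
have psi1 x : `|psi x| = 1 by rewrite normrM sg1 y1 ?inE // mulr1.
exists psi; split => // [g a gr|a d l lo].
  have [z zP] := bal g a gr; rewrite zP; case: z {zP} => [[b t]|]; last by rewrite normr0.
  by rewrite normrM sg1 y1 ?inE // mulr1.
pose Bd : R := orders_bound R kap #|B|.
have Bd_le : Bd <= 5760 * (2 * Num.sqrt r%:R).
  apply: le_trans (orders_bound_le _ _) _.
    by apply: leq_trans (up_logP _ _) => //; apply: leq_trans rK.
  by rewrite ler_wpM2l // (@growth_le_sqrt R r #|B| w) //; apply: leq_trans rK.
pose P e t : int := \sum_(x <- take t (E e)) psi x.
have P_le e t : (e < r)%N -> `|P e t|%:~R <= 2 ^+ w * Bd.
  move=> er; have -> : P e t = \sum_tau sg tau *
      \sum_(b <- take (count (fun x => ty x == tau) (take t (E e))) (s (Ordinal er, tau))) y b.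
    rewrite /P (partition_big ty predT) //=; apply: eq_bigr => tau _.
    rewrite /s /= -map_take -filter_take big_map big_filter mulr_sumr.
    by apply: eq_bigr => x /eqP tE; rewrite /psi tE.
  apply: (@le_trans _ _ (\sum_(tau : Ty) Bd)); last first.
    rewrite sumr_const -[leLHS]mulr_natl ler_wpM2r //; last by rewrite -natrX ler_nat.
    by apply: le_trans (orders_bound_ge _ _ _).
  apply: (@le_trans _ _ (\sum_tau `|sg tau *
      \sum_(b <- take (count (fun x => ty x == tau) (take t (E e))) (s (Ordinal er, tau))) y b|%:~R)).
    by rewrite -rmorph_sum ler_int ler_norm_sum.
  by apply: ler_sum => tau _; rewrite normrM sg1 mul1r; apply: yb.
have W0 : 0 <= 2 ^+ w :> R by apply: exprn_ge0.
have WBd := ler_wpM2l W0 Bd_le.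
have Wr : 0 <= 2 ^+ w * Num.sqrt r%:R :> R by rewrite mulr_ge0 ?sqrtr_ge0.
wlog dr : d lo / (d < r)%N.
  move=> W; have := W (d %% r)%N; rewrite gcdn_modl ltn_pmod // => /(_ lo isT).
  by under eq_bigr => k _ do rewrite -modnDmr modnMmr modnDmr.
set g := gcdn d r; set o := (r %/ g)%N in lo.
have g0 : (0 < g)%N by rewrite gcdn_gt0 r0 orbT.
have rE : r = (g * o)%N by rewrite mulnC divnK // dvdn_gcdr.
set c := (a %% g)%N; have cg : (c < g)%N by rewrite ltn_pmod.
(* [a] stands at place [k0] in the list of its coset that starts from [c]; the progression is a run
   from [k0] in that list read cyclically. *)
have [|k0 k0o k0P] := @ap_surj r c d a r0; first by rewrite modn_mod.
have PE u v : (u <= v)%N -> (v <= o)%N ->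
    \sum_(u <= i < v) psi ((c + i * d) %% r)%N = P d (c * o + v)%N - P d (c * o + u)%N.
  move=> uv vo.
  have PE t : (t <= o)%N -> P d (c * o + t)%N = P d (c * o)%N + \sum_(0 <= i < t) psi ((c + i * d) %% r)%N.
    move=> to; rewrite /P takeD big_cat /=; congr (_ + _).
    have co : (c * o + t <= r)%N by rewrite rE;
      apply: (@leq_trans (c.+1 * o)%N); rewrite ?leq_mul2r ?cg ?orbT // mulSnr leq_add2l.
    rewrite -map_drop -map_take drop_iota take_iota big_map add0n.
    have -> : minn t (r - c * o) = t by apply/minn_idPl; rewrite -{1}(addKn (c * o)%N t) leq_sub2r.
    rewrite -{1}[(c * o)%N]addn0 iotaDl big_map /index_iota subn0.
    apply: eq_big_seq => i; rewrite mem_iota add0n => /= it.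
    by rewrite coset_enumE //; apply: leq_trans to.
  rewrite !PE //; last by apply: leq_trans vo.
  by rewrite (@big_cat_nat _ _ _ u 0%N v) //=; ring.
have sumE : \sum_(k < l) psi ((a + k * d) %% r)%N = \sum_(k0 <= i < k0 + l) psi ((c + i * d) %% r)%N.
  rewrite -{1}[k0]add0n big_addn addKn big_mkord; apply: eq_bigr => k _; congr psi.
  by rewrite mulnDl [(k * d + _)%N]addnC addnA -modnDml -k0P modnDml.
rewrite sumE.
have [kl|kl] := leqP (k0 + l) o.
  rewrite PE ?leq_addr //.
  apply: (@le_trans _ _ (`|P d (c * o + (k0 + l))%N|%:~R + `|P d (c * o + k0)%N|%:~R)).
    by rewrite -intrD ler_int ler_normB.
  apply: le_trans (lerD (P_le _ _ dr) (P_le _ _ dr)) _.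
  by move: (2 ^+ w) (Num.sqrt _) WBd Wr => W q; clearbody Bd; lra.
(* As [l <= o], the run passes the end of the list at most once, leaving two intervals and hence
   four prefixes. *)
rewrite (@big_cat_nat _ _ _ o) /=; [|exact: ltnW|exact: ltnW].
have -> : \sum_(o <= i < k0 + l) psi ((c + i * d) %% r)%N =
          \sum_(0 <= i < k0 + l - o) psi ((c + i * d) %% r)%N.
  rewrite -{1}[o]add0n big_addn; apply: eq_bigr => i _; congr psi.
  have -> : (c + (i + o) * d = d %/ g * r + (c + i * d))%N.
    have : (o * d = d %/ g * r)%N by rewrite /o mulnC muln_divCA_gcd mulnC.
    by rewrite mulnDl => ->; ring.
  by rewrite modnMDl.
have k0o' := ltnW k0o.
have klo : (k0 + l - o <= o)%N by rewrite leq_subLR leq_add.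
rewrite !PE //.
set A1 := P d _; set A2 := P d _; set A3 := P d _; set A4 := P d _.
apply: (@le_trans _ _ ((`|A1|%:~R + `|A2|%:~R) + (`|A3|%:~R + `|A4|%:~R))).
  rewrite -!intrD ler_int; apply: le_trans (ler_normD _ _) _.
  by apply: lerD; apply: ler_normB.
apply: le_trans (lerD (lerD (P_le _ _ dr) (P_le _ _ dr)) (lerD (P_le _ _ dr) (P_le _ _ dr))) _.
(* The constant is [4 * 2 * 5760 = 46080 <= 2 ^ 16]. *)
by move: (2 ^+ w) (Num.sqrt _) WBd Wr => W q; clearbody Bd; lra.
Qed.

(** * Upper bound for Z_n *)

Lemma bigmin_seq_le (R : realDomainType) (I : eqType) (s : seq I) (x0 : R) (F : I -> R) i :
  i \in s -> \big[Num.min/x0]_(j <- s) F j <= F i.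
Proof.
elim: s => // j s IH; rewrite inE big_cons => /predU1P[->|/IH h]; rewrite ge_min ?lexx //.
by rewrite h orbT.
Qed.

Lemma disc_APn_le n (chi : {ffun 'I_n -> bool}) : (disc_APn n <= ap_disc chi)%N.
Proof.
rewrite /disc_APn; have : chi \in index_enum {ffun 'I_n -> bool} by rewrite mem_index_enum.
elim: (index_enum _) => // c s IH; rewrite inE big_cons => /predU1P[->|/IH h].
  exact: geq_minl.
by apply: leq_trans h; apply: geq_minr.
Qed.

Lemma disc_upper (R : realType) n r : (0 < n)%N -> (r %| n)%N ->
  (disc_APn n)%:R <= (n %/ r)%:R + 2 ^+ 16 * Num.sqrt r%:R * 2 ^+ omega r :> R.
Proof.
move=> n0 rn; have r0 : (0 < r)%N by apply: dvdn_gt0 rn.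
have [psi [psi1 psi_coset psi_ap]] := cyclic_colouring R r0.
pose chi : {ffun 'I_n -> bool} := [ffun x : 'I_n => psi (x %% r)%N == 1].
set rhs := (X in _ <= X).
have rhs0 : 0 <= rhs by rewrite addr_ge0 // !mulr_ge0 ?sqrtr_ge0 ?exprn_ge0.
have fE (x : 'I_n) : psi (x %% r)%N = if chi x then 1 else -1.
  by rewrite ffunE; case: eqP => // ne; move: (psi1 (x %% r)%N) ne; move: (psi _) => v; lia.
apply: (@le_trans _ _ (ap_disc chi)%:R); first by rewrite ler_nat disc_APn_le.
rewrite /ap_disc; pose K (m : nat) := m%:R <= rhs.
have Kmax x y : K x -> K y -> K (maxn x y) by rewrite /K /maxn; case: ifP.
rewrite -/(K _); apply: (big_ind K) => //.
move=> a _; apply: (big_ind K) => //.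
move=> d _; apply: (big_ind K) => //.
move=> l lo; rewrite /K (col_sum_AP a (f := fun x => psi (x %% r)%N) fE) // (_ : _%:R = `|\sum_(k < l) psi (((a + k * d) %% n) %% r)%N|%:~R); last first.
  by rewrite -abszE.
under eq_bigr => k _ do rewrite modn_dvdm //.
set g := gcdn d r; set o := (r %/ g)%N.
have g0 : (0 < g)%N by rewrite gcdn_gt0 r0 orbT.
have o0 : (0 < o)%N by rewrite divn_gt0 // dvdn_leq // dvdn_gcdr.
have per k : psi ((a + (k + o) * d) %% r)%N = psi ((a + k * d) %% r)%N.
  congr psi; have e2 : (o * d = d %/ g * r)%N by rewrite mulnC muln_divCA_gcd mulnC.
  by rewrite mulnDl e2 addnA addnC modnMDl.
have := sum_periodic (l %/ o) (l %% o) per; rewrite -divn_eq => ->.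
set w := (l %/ o)%N.
(* [w * o <= l <= n / gcdn d n] and [gcdn d r <= gcdn d n] bound the number of full periods; each of
   them is a coset sum of absolute value at most 1. *)
have wn : (w <= n %/ r)%N.
  have oE : (o * g = r)%N by rewrite divnK // dvdn_gcdr.
  rewrite leq_divRL // -oE mulnA.
  have gn : (g <= gcdn d n)%N.
    by rewrite dvdn_leq ?gcdn_gt0 ?n0 ?orbT // dvdn_gcd dvdn_gcdl (dvdn_trans (dvdn_gcdr _ _)).
  apply: (@leq_trans (l * gcdn d n)%N); first by rewrite leq_mul // leq_trunc_div.
  by rewrite -leq_divRL ?gcdn_gt0 ?n0 ?orbT.
apply: (@le_trans _ _ (w%:R + `|\sum_(k < l %% o) psi ((a + k * d) %% r)%N|%:~R)).
  rewrite (_ : w%:R = w%:~R) // -intrD ler_int; apply: le_trans (ler_normD _ _) _.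
  rewrite lerD2r normrM sum_coset // normr_nat natz -[leRHS]mulr1 ler_wpM2l // psi_coset // dvdn_gcdr //.
apply: lerD; first by rewrite ler_nat.
by apply: psi_ap; apply/ltnW; rewrite ltn_pmod.
Qed.

(** * Fourier analysis on Z_n *)

Section Fourier.
Local Open Scope complex_scope.
Variables (R : realType) (n : nat).
Hypothesis n_gt0 : (0 < n)%N.

Definition sqn (w : R[i]) : R := complex.Re w ^+ 2 + complex.Im w ^+ 2.

Lemma sqnE w : (sqn w)%:C = w * conjc w.
Proof. by case: w => a b; rewrite /sqn; simpc; congr (_ +i* _); ring. Qed.

Lemma sqn_ge0 w : 0 <= sqn w. Proof. by rewrite addr_ge0 ?sqr_ge0. Qed.

Lemma sqnM v w : sqn (v * w) = sqn v * sqn w.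
Proof. by case: v => a b; case: w => c d; rewrite /sqn; simpc => /=; ring. Qed.

Lemma sqnJ w : sqn (conjc w) = sqn w.
Proof. by case: w => a b; rewrite /sqn /= sqrrN. Qed.

Definition cis (x : R) : R[i] := cos x +i* sin x.

Lemma cisD x y : cis (x + y) = cis x * cis y.
Proof. by rewrite /cis; simpc; rewrite cosD sinD; congr (_ +i* _); ring. Qed.

Lemma cis0 : cis 0 = 1. Proof. by rewrite /cis cos0 sin0. Qed.

Lemma cisX x k : cis x ^+ k = cis (x * k%:R).
Proof.
elim: k => [|k IH]; first by rewrite mulr0 cis0 expr0.
by rewrite exprS IH -cisD -natr1; congr cis; ring.
Qed.

Lemma conj_cis x : conjc (cis x) = cis (- x).
Proof. by rewrite /cis cosN sinN. Qed.

Let zeta : R[i] := cis (2 * pi / n%:R).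

Let nR : (n%:R : R) != 0. Proof. by rewrite pnatr_eq0 -lt0n. Qed.

Let zeta_n : zeta ^+ n = 1.
Proof. by rewrite cisX divfK // /cis mulr_natl cos2pi sin2pi. Qed.

Let zetaJ k : zeta ^+ k * conjc zeta ^+ k = 1.
Proof. by rewrite -exprMn conj_cis -cisD subrr cis0 expr1n. Qed.

(** With [theta = pi * k / n] in the open interval from 0 to [pi], the real part of the power is
    [cos (2 * theta)], below 1 because [sin theta > 0]. *)
Let zeta_prim k : (0 < k < n)%N -> zeta ^+ k != 1.
Proof.
case/andP=> k0 kn; rewrite cisX; apply/eqP => /(congr1 (fun w : R[i] => complex.Re w)) /=.
have -> : 2 * pi / n%:R * k%:R = (pi * (k%:R / n%:R)) *+ 2 :> R.
  by rewrite mulr2n; field.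
rewrite cos_mulr2n; have := cos2Dsin2 (pi * (k%:R / n%:R) : R).
have kn1 : k%:R / n%:R < 1 :> R by rewrite ltr_pdivrMr ?ltr0n // mul1r ltr_nat.
have kn0 : 0 < k%:R / n%:R :> R by rewrite divr_gt0 ?ltr0n.
have : 0 < sin (pi * (k%:R / n%:R) : R).
  apply: sin_gt0_pi; rewrite mulr_gt0 ?pi_gt0 //=.
  by rewrite -[ltRHS]mulr1 ltr_pM2l ?pi_gt0.
move: (sin _) (cos _) => s c s0 h1 h2; have : 0 < s ^+ 2 by apply: exprn_gt0.
by move: h1 h2; move: (s ^+ 2) (c ^+ 2) => s2 c2; lra.
Qed.

Definition ft (h : nat -> R[i]) (u : R[i]) : R[i] := \sum_(x < n) h x * u ^+ x.

Lemma orthogonality (x y : 'I_n) :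
  \sum_(t < n) (zeta ^+ x * conjc zeta ^+ y) ^+ t = if x == y then n%:R else 0.
Proof.
case: eqVneq => [->|xy].
  by under eq_bigr => t _ do rewrite zetaJ expr1n; rewrite sumr_const card_ord.
set w := _ * _; have wn : w ^+ n = 1.
  have zJn : conjc zeta ^+ n = 1 by rewrite -rmorphXn zeta_n rmorph1.
  by rewrite /w exprMn (exprAC _ x n) (exprAC _ y n) zeta_n zJn !expr1n mulr1.
have w1 : w != 1.
  have Jinv k : conjc zeta ^+ k = 1 -> zeta ^+ k = 1.
    by move=> e; have := zetaJ k; rewrite e mulr1.
  rewrite /w; case: (ltngtP x y) => [lt|lt|/val_inj e]; last by rewrite e eqxx in xy.
    rewrite -(subnKC (ltnW lt)) exprD mulrA zetaJ mul1r; apply/eqP => /Jinv/eqP.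
    by apply/negP/zeta_prim; rewrite subn_gt0 lt /=; apply: leq_ltn_trans (ltn_ord y); apply: leq_subr.
  rewrite -(subnK (ltnW lt)) exprD -mulrA zetaJ mulr1; apply: zeta_prim.
  by rewrite subn_gt0 lt /=; apply: leq_ltn_trans (ltn_ord x); apply: leq_subr.
apply/eqP; have := subrX1 w n; rewrite wn subrr => /esym/eqP.
by rewrite mulf_eq0 subr_eq0 (negbTE w1).
Qed.

Lemma parseval (h : nat -> R[i]) :
  \sum_(t < n) sqn (ft h (zeta ^+ t)) = n%:R * \sum_(x < n) sqn (h x).
Proof.
apply: (@complexI R); rewrite rmorph_sum rmorphM rmorph_nat rmorph_sum /=.
under eq_bigr => t _ do rewrite sqnE.
under [in RHS]eq_bigr => t _ do rewrite sqnE.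
have expand (t : 'I_n) : ft h (zeta ^+ t) * conjc (ft h (zeta ^+ t)) =
    \sum_(x < n) \sum_(y < n) (h x * conjc (h y)) * (zeta ^+ x * conjc zeta ^+ y) ^+ t.
  rewrite /ft rmorph_sum mulr_suml; apply: eq_bigr => x _; rewrite mulr_sumr; apply: eq_bigr => y _.
  rewrite rmorphM !rmorphXn /= exprMn -!exprM (mulnC x) (mulnC y).
  by ring.
under eq_bigr => t _ do rewrite expand.
rewrite exchange_big mulr_sumr /=; apply: eq_bigr => x _.
rewrite exchange_big /=.
under eq_bigr => y _ do rewrite -mulr_sumr orthogonality.
rewrite (bigD1 x isT) /= eqxx [X in _ + X]big1; first by rewrite addr0 mulrC.
by move=> y /negbTE yx; rewrite eq_sym yx mulr0.
Qed.

Lemma sum_shift (V : nmodType) (G : nat -> V) s : \sum_(a < n) G ((a + s) %% n)%N = \sum_(a < n) G a.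
Proof.
pose h (a : 'I_n) : 'I_n := Ordinal (ltn_pmod (a + s) n_gt0).
have h_inj : injective h.
  move=> a b /(congr1 val) /= /eqP; rewrite eqn_modDr !modn_small // => /eqP; exact: val_inj.
by rewrite [RHS](reindex_inj h_inj).
Qed.

Lemma ft_shift h u s : u ^+ n = 1 -> u * conjc u = 1 ->
  ft (fun a => h ((a + s) %% n)%N) u = conjc u ^+ s * ft h u.
Proof.
move=> un uu; have us : u ^+ s * conjc u ^+ s = 1 by rewrite -exprMn uu expr1n.
rewrite /ft -(sum_shift (fun x => h x * u ^+ x) s) mulr_sumr; apply: eq_bigr => a _.
rewrite (expr_mod _ un) exprD mulrCA; congr (_ * _).
by rewrite mulrCA [conjc u ^+ s * _]mulrC us mulr1.
Qed.

Definition ap_sum (V : nmodType) (h : nat -> V) (d l a : nat) : V := \sum_(k < l) h ((a + k * d) %% n)%N.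

(** Summing over translates is a convolution, so the transform is multiplied by the geometric sum of
    the progression. *)
Lemma ft_ap_sum h u d l : u ^+ n = 1 -> u * conjc u = 1 ->
  ft (ap_sum h d l) u = (\sum_(k < l) (conjc u ^+ d) ^+ k) * ft h u.
Proof.
move=> un uu; rewrite mulr_suml.
rewrite /ft /ap_sum; under eq_bigr => a _ do rewrite mulr_suml.
rewrite exchange_big /=; apply: eq_bigr => k _.
by rewrite -exprM mulnC -ft_shift.
Qed.

Lemma energy (f : nat -> R) d l :
  n%:R * \sum_(a < n) ap_sum f d l a ^+ 2 =
  \sum_(t < n) sqn (ft (fun x => (f x)%:C) (zeta ^+ t)) *
     sqn (\sum_(k < l) ((zeta ^+ t) ^+ d) ^+ k).
Proof.
have -> : \sum_(a < n) ap_sum f d l a ^+ 2 = \sum_(a < n) sqn (ap_sum (fun x => (f x)%:C) d l a).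
  apply: eq_bigr => a _; rewrite /ap_sum -rmorph_sum /sqn /= expr0n addr0 //.
rewrite -parseval; apply: eq_bigr => t _.
have zn : (zeta ^+ t) ^+ n = 1 by rewrite -exprM mulnC exprM zeta_n expr1n.
have zz : zeta ^+ t * conjc (zeta ^+ t) = 1 by rewrite rmorphXn /= zetaJ.
rewrite (ft_ap_sum _ _ _ zn zz) sqnM mulrC; congr (_ * _).
move: (zeta ^+ t) => u; rewrite -sqnJ rmorph_sum; congr sqn; apply: eq_bigr => k _.
by rewrite !rmorphXn /= conjcK.
Qed.

(** [cos (2 * x) >= 0] gives [2 * cos x ^+ 2 >= 1], and 7/10 is a rational below
    [1 / Num.sqrt 2]. *)
Lemma cos_ge_7_10 (x : R) : `|x| <= pi / 4 -> 7 / 10 <= cos x.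
Proof.
rewrite ler_norml => /andP[h1 h2]; have p0 := pi_gt0 R.
have c0 : 0 <= cos x by apply: cos_ge0_pihalf; apply/andP; split; lra.
have : 0 <= cos (x *+ 2) by apply: cos_ge0_pihalf; rewrite [x *+ 2]mulr2n; apply/andP; split; lra.
rewrite cos_mulr2n; move: (cos x) c0 => c c0 h; rewrite leNgt; apply/negP => c7.
have c7' : 0 <= 7 / 10 - c by lra.
by have := mulr_ge0 c0 c7'; move: h; rewrite [_ ^+ 2 *+ 2]mulr2n; lra.
Qed.

(** The squared modulus is the double sum of [cos (x * (k - j))], and every such angle lies within
    [pi / 4]. *)
Lemma dirichlet_kernel_ge (x : R) l : `|x| * l.-1%:R <= pi / 4 ->
  7 / 10 * l%:R ^+ 2 <= sqn (\sum_(k < l) cis x ^+ k).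
Proof.
move=> xl.
have -> : \sum_(k < l) cis x ^+ k = (\sum_(k < l) cos (x * k%:R)) +i* (\sum_(k < l) sin (x * k%:R)).
  elim: (l) => [|m IH]; first by rewrite !big_ord0.
  by rewrite !big_ord_recr /= IH cisX /cis; simpc.
rewrite /sqn /= !expr2 !mulr_suml -big_split /=.
have -> : 7 / 10 * (l%:R * l%:R) = \sum_(k < l) \sum_(j < l) (7 / 10) :> R.
  by under eq_bigr => k _ do rewrite sumr_const card_ord; rewrite sumr_const card_ord -mulrnA -natrM mulr_natr.
apply: ler_sum => k _; rewrite !mulr_sumr -big_split /=; apply: ler_sum => j _.
rewrite -cosB; apply: cos_ge_7_10; apply: le_trans xl.
rewrite -mulrBr normrM ler_wpM2l //.
have lt (i : 'I_l) : (i%:R : R) <= l.-1%:R by rewrite ler_nat; have := ltn_ord i; lia.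
have := lt k; have := lt j; have : 0 <= (k%:R : R) by []; have : 0 <= (j%:R : R) by [].
by rewrite ler_norml => *; apply/andP; split; lra.
Qed.

(** * Lower bound from the Fourier mass of each order *)

Section LowerBound.
Variables (f : nat -> R) (Delta : R).
Hypothesis f2 : forall x, (x < n)%N -> f x ^+ 2 = 1.
Hypothesis f_disc : forall d l a, (a < n)%N -> (l <= n %/ gcdn d n)%N ->
  `|ap_sum f d l a| <= Delta.

Let F (t : nat) : R := sqn (ft (fun x => (f x)%:C) (zeta ^+ t)).
Let ord (t : nat) : nat := (n %/ gcdn t n)%N.
Let W (r : nat) : R := \sum_(t < n | ord t == r) F t.

Let F_ge0 t : 0 <= F t. Proof. exact: sqn_ge0. Qed.

Let energy_le d l : (l <= n %/ gcdn d n)%N ->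
  n%:R * \sum_(a < n) ap_sum f d l a ^+ 2 <= n%:R ^+ 2 * Delta ^+ 2.
Proof.
move=> ln; rewrite expr2 -mulrA ler_wpM2l // mulr_natl.
apply: (@le_trans _ _ (\sum_(a < n) Delta ^+ 2)); last by rewrite sumr_const card_ord.
apply: ler_sum => a _; rewrite -real_normK ?num_real //.
have h := f_disc (ltn_ord a) ln; apply: lerXn2r; rewrite ?nnegrE //.
exact: le_trans h.
Qed.

Let sum_F : \sum_(t < n) F t = n%:R ^+ 2.
Proof.
rewrite /F parseval expr2; congr (_ * _).
rewrite -[RHS]mulr1 mulr_natl -[n in RHS]card_ord -sumr_const.
by apply: eq_bigr => x _; rewrite /sqn /= expr0n addr0 f2.
Qed.

Let sum_W : \sum_(r <- divisors n) W r = n%:R ^+ 2.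
Proof.
rewrite -sum_F /W (exchange_big_dep predT) //=; apply: eq_bigr => t _.
rewrite -big_filter (_ : [seq r <- divisors n | ord t == r] = [:: ord t]) ?big_seq1 //.
have od : ord t \in divisors n by rewrite -dvdn_divisors // /ord dvdn_div // dvdn_gcdr.
have := filter_pred1_uniq (divisors_uniq n) od => <-.
by apply: eq_filter => r; rewrite /= eq_sym.
Qed.

Let W_alpha r : (r %| n)%N -> W r * (n %/ r)%:R ^+ 2 <= n%:R ^+ 2 * Delta ^+ 2.
Proof.
move=> rn; have le : (n %/ r <= n %/ gcdn r n)%N by rewrite (gcdn_idPl rn).
apply: le_trans (energy_le le); rewrite energy /W mulr_suml.
rewrite big_mkcond; apply: ler_sum => t _; case: ifP => [/eqP tr|_]; last by rewrite mulr_ge0 ?sqn_ge0.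
rewrite ler_wpM2l ?F_ge0 //.
have -> : (zeta ^+ t) ^+ r = 1.
  have : (n %| r * t)%N by rewrite dvdn_mul_gcd // -/(ord t) tr.
  by case/dvdnP => q qE; rewrite -exprM mulnC qE mulnC exprM zeta_n expr1n.
under eq_bigr => k _ do rewrite expr1n.
rewrite sumr_const card_ord (_ : (1 : R[i]) *+ _ = ((n %/ r)%:R : R)%:C); last by rewrite rmorph_nat.
by rewrite /sqn /= expr0n addr0.
Qed.

(** Differences [d1], [d2] turn [zeta ^+ t] into [cis] of [2 * pi / r] and of its opposite. Each
    kernel is at least [7 / 10 * l ^ 2] with [l >= r / 8], and [2 * (7 / 10) / 64 >= 1 / 49]. For
    [r < 8] one has [l = 1] and a single kernel, equal to 1, suffices. *)
Let kernel_sum r l (t : 'I_n) : ord t = r -> l = ((r + 7) %/ 8)%N ->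
  r%:R ^+ 2 / 49 <= \sum_(d < r | (l <= n %/ gcdn d n)%N)
    sqn (\sum_(k < l) ((zeta ^+ t) ^+ d) ^+ k).
Proof.
move=> tr lE; set g := gcdn t n.
have g0 : (0 < g)%N by rewrite gcdn_gt0 n_gt0 orbT.
have nE : n = (r * g)%N by rewrite -tr /ord divnK // dvdn_gcdr.
have r0 : (0 < r)%N by move: n_gt0; rewrite nE muln_gt0 => /andP[].
have gn : (g <= n)%N by rewrite nE leq_pmull.
have lr : (l <= r)%N by rewrite lE; move: (r) r0; clear; lia.
(* For such differences [gcdn d n] divides [g], so progressions of length [r >= l] are
   admissible. *)
have ok d x : (d * t)%N = x %[mod n] -> x = g \/ x = (n - g)%N -> (l <= n %/ gcdn d n)%N.
  move=> dx xg; apply: leq_trans lr _.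
  have dg : (gcdn d n %| g)%N.
    have dvx : (gcdn d n %| x)%N.
      rewrite /dvdn -(modn_dvdm x (dvdn_gcdr d n)) -dx modn_dvdm ?dvdn_gcdr //.
      by rewrite -/(dvdn _ _) dvdn_mulr // dvdn_gcdl.
    by case: xg => xE; move: dvx; rewrite xE // dvdn_subr // dvdn_gcdr.
  rewrite leq_divRL ?gcdn_gt0 ?n_gt0 ?orbT // [X in (_ <= X)%N]nE leq_mul2l.
  by rewrite dvdn_leq ?orbT.
have [|d1 d1r d1P] := @ap_surj n 0 t g n_gt0; first by rewrite mod0n modnn.
have [|d2 d2r d2P] := @ap_surj n 0 t (n - g) n_gt0.
  by rewrite mod0n; apply/esym/eqP; rewrite -/(dvdn _ _) dvdn_sub ?dvdn_gcdr.
rewrite add0n in d1P d2P; rewrite -/g -/(ord t) tr in d1r d2r.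
have ok1 := ok _ _ d1P (or_introl erefl); have ok2 := ok _ _ d2P (or_intror erefl).
set o1 := Ordinal d1r; set o2 := Ordinal d2r.
have S0 d : 0 <= sqn (\sum_(k < l) ((zeta ^+ t) ^+ d) ^+ k) by apply: sqn_ge0.
have [r8|r8] := ltnP r 8.
  rewrite (bigD1 o1 ok1) /=; apply: ler_wpDr; first by apply: sumr_ge0 => d _; apply: S0.
  have l1 : l = 1%N by rewrite lE; move: (r) r0 r8; clear; lia.
  rewrite l1 big_ord1 expr0 /sqn /= expr1n expr0n addr0 ler_pdivrMr // mul1r.
  have r7 : r%:R <= 7 :> R by rewrite ler_nat.
  have rr : 0 <= r%:R :> R by [].
  apply: (@le_trans _ _ (7 ^+ 2)); last by lra.
  by apply: lerXn2r; rewrite ?nnegrE.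
have zE d x : (d * t)%N = x %[mod n] -> (zeta ^+ t) ^+ d = zeta ^+ x.
  by move=> e; rewrite -exprM mulnC -(expr_mod _ zeta_n) e (expr_mod _ zeta_n).
have rR : 0 < r%:R :> R by rewrite ltr0n.
have zg : zeta ^+ g = cis (2 * pi / r%:R).
  rewrite cisX; congr cis; rewrite [in LHS]nE natrM.
  by field; rewrite !pnatr_eq0 -!lt0n g0 r0.
have zng : zeta ^+ (n - g) = cis (- (2 * pi / r%:R)).
  rewrite -conj_cis -zg -[LHS]mulr1 -(zetaJ g) mulrA -exprD subnK // zeta_n mul1r.
  by rewrite rmorphXn.
have l1r : (8 * l.-1 <= r)%N by rewrite lE; move: (r) r0; clear; lia.
have lge : (r <= 8 * l)%N by rewrite lE; move: (r) r0; clear; lia.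
have arg : 2 * pi / r%:R * l.-1%:R <= pi / 4 :> R.
  rewrite mulrAC ler_pdivrMr //.
  have : 8 * l.-1%:R <= r%:R :> R by rewrite -natrM ler_nat.
  by move/(ler_wpM2l (ltW (pi_gt0 R))); lra.
have arg0 : 0 <= 2 * pi / r%:R :> R by rewrite divr_ge0 // mulr_ge0 // pi_ge0.
have K1 : 7 / 10 * l%:R ^+ 2 <= sqn (\sum_(k < l) ((zeta ^+ t) ^+ d1) ^+ k).
  by rewrite (zE _ _ d1P) zg dirichlet_kernel_ge // ger0_norm.
have K2 : 7 / 10 * l%:R ^+ 2 <= sqn (\sum_(k < l) ((zeta ^+ t) ^+ d2) ^+ k).
  by rewrite (zE _ _ d2P) zng dirichlet_kernel_ge // normrN ger0_norm.
have d12 : o2 != o1.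
  apply/eqP => /(congr1 val) /= e; move: d1P; rewrite -e d2P.
  have gn' : (g < n)%N by rewrite nE -[X in (X < _)%N]mul1n ltn_mul2r g0 (leq_trans _ r8).
  rewrite !modn_small //; last by rewrite ltn_subrL g0.
  move=> ng; have : n = (2 * g)%N by rewrite mul2n -addnn -{2}ng subnKC.
  by rewrite nE => /eqP; rewrite eqn_pmul2r // => /eqP r2; rewrite r2 in r8.
rewrite (bigD1 o1 ok1) (bigD1 o2) /=; last by rewrite ok2.
rewrite addrA; apply: ler_wpDr; first by apply: sumr_ge0 => d _; apply: S0.
apply: le_trans (lerD K1 K2).
have : r%:R <= 8 * l%:R :> R by rewrite -natrM ler_nat.
move=> rl; have : r%:R ^+ 2 <= (8 * l%:R) ^+ 2 :> R by apply: lerXn2r; rewrite ?nnegrE ?mulr_ge0.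
by rewrite exprMn; have := sqr_ge0 (l%:R : R); lra.
Qed.

Let W_beta r : (r %| n)%N -> W r * r%:R <= 49 * (n%:R ^+ 2 * Delta ^+ 2).
Proof.
move=> rn; have r0 : (0 < r)%N by apply: dvdn_gt0 rn.
set l := ((r + 7) %/ 8)%N.
have h1 : \sum_(d < r | (l <= n %/ gcdn d n)%N) n%:R * \sum_(a < n) ap_sum f d l a ^+ 2
    <= r%:R * (n%:R ^+ 2 * Delta ^+ 2).
  apply: (@le_trans _ _ (\sum_(d < r) n%:R ^+ 2 * Delta ^+ 2)); last first.
    by rewrite sumr_const card_ord mulr_natl.
  rewrite big_mkcond; apply: ler_sum => d _; case: ifP => [/energy_le //|_].
  by rewrite mulr_ge0 ?sqr_ge0.
have h2 : W r * (r%:R ^+ 2 / 49) <= r%:R * (n%:R ^+ 2 * Delta ^+ 2).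
  apply: le_trans h1.
  under eq_bigr => d _ do rewrite energy.
  rewrite exchange_big /= /W mulr_suml big_mkcond; apply: ler_sum => t _.
  case: ifP => [/eqP tr|_]; last by apply: sumr_ge0 => d _; rewrite mulr_ge0 ?sqn_ge0.
  by rewrite -mulr_sumr ler_wpM2l ?F_ge0 //; apply: kernel_sum.
have rR : 0 < r%:R :> R by rewrite ltr0n.
rewrite -(ler_pM2l rR); move: h2; rewrite expr2; move: (W r) (n%:R ^+ 2 * _) (r%:R) => w A q; lra.
Qed.

Lemma disc_lower (m0 : R) : 0 <= m0 ->
  (forall r, (r %| n)%N -> m0 <= (n %/ r)%:R + Num.sqrt r%:R) ->
  m0 <= 8 * Num.sqrt (ndiv n)%:R * Delta.
Proof.
move=> m00 m0_le.
have D0 : 0 <= Delta by apply: le_trans (@f_disc 0%N 0%N 0%N _ _).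
have W0 r : 0 <= W r by apply: sumr_ge0 => t _; exact: F_ge0.
have key r : r \in divisors n -> W r * m0 ^+ 2 <= 64 * (n%:R ^+ 2 * Delta ^+ 2).
  rewrite -dvdn_divisors // => rn.
  have := W_alpha rn; have := W_beta rn; have := m0_le r rn.
  have : Num.sqrt r%:R ^+ 2 = r%:R :> R by rewrite sqr_sqrtr.
  have : 0 <= Num.sqrt r%:R :> R by rewrite sqrtr_ge0.
  have := W0 r; have : 0 <= (n %/ r)%:R :> R by [].
  move: (W r) (Num.sqrt _) (n %/ r)%:R (n%:R ^+ 2 * _) => w y x A x0 w0 y0 <- mle h1 h2.
  (* The weights balance the two bounds on [W r]: they come from [(7 x - y)^2 >= 0], and
     [8 + (8 / 7) * 49 = 64] is the square of the final constant 8. *)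
  have : m0 ^+ 2 <= 8 * x ^+ 2 + 8 / 7 * y ^+ 2.
    apply: (@le_trans _ _ ((x + y) ^+ 2)).
      by apply: lerXn2r; rewrite ?nnegrE // addr_ge0.
    have := sqr_ge0 (7 * x - y); lra.
  by move/(ler_wpM2l w0); lra.
have : n%:R ^+ 2 * m0 ^+ 2 <= (ndiv n)%:R * (64 * (n%:R ^+ 2 * Delta ^+ 2)).
  rewrite -{1}sum_W mulr_suml mulr_natl.
  apply: (@le_trans _ _ (\sum_(r <- divisors n) 64 * (n%:R ^+ 2 * Delta ^+ 2))).
    by rewrite big_seq [leRHS]big_seq; apply: ler_sum.
  by rewrite big_const_seq count_predT iter_addr_0.
have nn : 0 < n%:R ^+ 2 :> R by rewrite exprn_gt0 ?ltr0n.
rewrite [X in _ <= X](_ : _ = n%:R ^+ 2 * ((ndiv n)%:R * (64 * Delta ^+ 2))); last by ring.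
rewrite ler_pM2l // => h.
rewrite -(ler_pXn2r (n := 2)) ?nnegrE // ?mulr_ge0 ?sqrtr_ge0 //.
by rewrite !exprMn sqr_sqrtr //; lra.
Qed.

End LowerBound.
End Fourier.

(** * The two bounds *)

Lemma ap_disc_ge n (chi : {ffun 'I_n -> bool}) (a d : 'I_n) l : (l <= n %/ gcdn d n)%N ->
  (`|col_sum chi (AP a d l)| <= ap_disc chi)%N.
Proof.
move=> ln; have l1 : (l < n.+1)%N by rewrite ltnS (leq_trans ln) // leq_div.
apply: leq_trans (leq_bigmax_cond _ (isT : predT a)).
apply: leq_trans (leq_bigmax_cond _ (isT : predT d)).
exact: (@leq_bigmax_cond _ _ (fun l : 'I_n.+1 => absz (col_sum chi (AP a d l))) (Ordinal l1)).
Qed.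

Lemma ap_disc_lower (R : realType) n (chi : {ffun 'I_n -> bool}) (m0 : R) : (0 < n)%N -> 0 <= m0 ->
  (forall r, (r %| n)%N -> m0 <= (n %/ r)%:R + Num.sqrt r%:R) ->
  m0 <= 8 * Num.sqrt (ndiv n)%:R * (ap_disc chi)%:R.
Proof.
move=> n0 m00 m0_le.
(* The value 1 beyond [n] is a dummy, since arguments are always reduced modulo [n]. *)
pose f0 (x : nat) : int := if insub x is Some i then (if chi i then 1 else -1) else 1.
have f0E (x : 'I_n) : f0 x = if chi x then 1 else -1 by rewrite /f0 valK.
apply: (@disc_lower R n n0 (fun x => (f0 x)%:~R)) => // [x xn|d l a an ln].
  by have := f0E (Ordinal xn) => /= ->; case: ifP => _; rewrite ?expr1n // sqrrN expr1n.
have dn : (d %% n < n)%N by rewrite ltn_pmod.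
have -> : ap_sum n (fun x => (f0 x)%:~R : R) d l a =
    (col_sum chi (AP (Ordinal an) (Ordinal dn) l))%:~R.
  rewrite (@col_sum_AP _ _ _ _ _ f0) //= ?gcdn_modl // rmorph_sum; apply: eq_bigr => k _.
  by rewrite -modnDmr -modnMmr modnDmr.
rewrite -intr_norm -abszE (_ : (Posz _)%:~R = (absz (col_sum chi (AP (Ordinal an) (Ordinal dn) l)))%:R) //.
by rewrite ler_nat ap_disc_ge //= gcdn_modl.
Qed.

Theorem theorem1p1 (R : realType) :
  exists c : R, 0 < c /\
    forall n : nat, (0 < n)%N ->
      (1 / (8 * Num.sqrt (ndiv n)%:R)) *
          @min_div R n (fun r => (n %/ r)%:R + Num.sqrt r%:R)
        <= (disc_APn n)%:R
      /\ (disc_APn n)%:R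
        <= @min_div R n (fun r => (n %/ r)%:R + c * Num.sqrt r%:R * 2%:R ^+ omega r).
Proof.
exists (2 ^+ 16); split => [|n n0]; first by rewrite exprn_gt0.
split; last first.
  rewrite /min_div big_seq; apply: (big_ind (fun v : R => (disc_APn n)%:R <= v)) => [|x y hx hy|r].
  - exact: (disc_upper R n0 (dvd1n n)).
  - by rewrite le_min hx hy.
  - by rewrite -dvdn_divisors // => rn; exact: (disc_upper R n0 rn).
set m0 := min_div _ _.
have m0_le r : (r %| n)%N -> m0 <= (n %/ r)%:R + Num.sqrt r%:R.
  by move=> rn; apply: (bigmin_seq_le _ (fun r => _)); rewrite -dvdn_divisors.
have m00 : 0 <= m0.
  rewrite /m0 /min_div; apply: (big_ind (fun v : R => 0 <= v)) => [|x y hx hy|r _].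
  - by rewrite addr_ge0 // sqrtr_ge0.
  - by rewrite le_min hx hy.
  - by rewrite addr_ge0 // sqrtr_ge0.
have d1 : 1 <= Num.sqrt (ndiv n)%:R :> R.
  rewrite -[X in X <= _]sqrtr1 ler_wsqrtr // ler1n /ndiv lt0n size_eq0.
  by apply/eqP => e; have := dvd1n n; rewrite dvdn_divisors // e.
have d0 : 0 < 8 * Num.sqrt (ndiv n)%:R :> R by lra.
rewrite mul1r mulrC ler_pdivrMr // mulrC.
rewrite /disc_APn; apply: (big_ind (fun m : nat => m0 <= 8 * Num.sqrt (ndiv n)%:R * m%:R)).
(* The seed [n] of the minimum over colourings: [r = 1] gives [m0 <= n + 1 <= 8 * n]. *)
- apply: le_trans (m0_le 1%N (dvd1n n)) _; rewrite divn1 sqrtr1.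
  have n1 : 1 <= n%:R :> R by rewrite ler1n.
  by have := ler_wpM2r (le_trans ler01 n1) d1; rewrite mul1r -mulrA; lra.
- by move=> x y hx hy; rewrite /minn; case: ifP.
- by move=> chi _; apply: ap_disc_lower.
Qed.
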